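(* Let $X$ be a compact locally $\mathrm{CAT}(0)$ geodesic metric space with topologically transitive geodesic flow such that its universal cover $\tilde X$ admits a fat $1$-flat. Then: (1) the geodesic flow $(GX,\{g_t\})$ does not satisfy weak specification; (2) there does not exist an orbit semi-equivalence $h:\mathrm{Susp}(\Sigma,\sigma)\to GX$, where $(\Sigma,\sigma)$ is a compact subshift of finite type.
   Context: A geodesic metric space is $\mathrm{CAT}(0)$ if for every geodesic triangle with comparison triangle in the Euclidean plane (same side lengths), distances between points on the triangle are at most the distances between the comparison points; it is locally $\mathrm{CAT}(0)$ if every point has a $\mathrm{CAT}(0)$ neighborhood. $\tilde X$ is the universal cover of $X$. $\tilde X$ has a fat $1$-flat if there exists a geodesic $\gamma$ in $\tilde X$ such that for some $w>0$ the $w$-neighborhood $N_w(\gamma)$ of $\gamma$ splits isometrically as $\mathbb{R}\times Y$ (with $\gamma$ in the direction of the $\mathbb{R}$-factor). $GX$ is the set of locally isometric maps $\gamma:\mathbb{R}\to X$, with geodesic flow $(g_t\gamma)(s)=\gamma(s+t)$ and metric $d_{GX}(\gamma_1,\gamma_2)=\inf_{\tilde\gamma_1,\tilde\gamma_2}\int_{-\infty}^{\infty}d_{\tilde X}(\tilde\gamma_1(t),\tilde\gamma_2(t))e^{-2|t|}dt$ (infimum over lifts to $\tilde X$). A (two-sided) subshift of finite type is a closed shift-invariant subset $\Sigma\subset\mathcal{A}^{\mathbb{Z}}$, $\mathcal{A}$ a finite alphabet, described by a finite set of forbidden words, with the left shift $\sigma$. $\mathrm{Susp}(\Sigma,\sigma)$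 is $(\Sigma\times[0,1])/\sim$, $(x,1)\sim(\sigma x,0)$, with the flow given locally by $\phi_t(x,s)=(x,s+t)$. An orbit semi-equivalence from a continuous flow $(Z_1,\{f_s\})$ to $(Z_2,\{g_s\})$ is a continuous surjection $h:Z_1\to Z_2$ whose restriction to any $\{f_s\}$-orbit is an orientation-preserving local homeomorphism onto a $\{g_s\}$-orbit. A flow $\{f_s\}$ on a compact metric space $(Z,d)$ is topologically transitive if for all nonempty open $U,V$ there is $t\ge0$ with $f_tU\cap V\ne\emptyset$. It has weak specification if for every $\delta>0$ there exists $\tau>0$ such that for every finite collection $\{(x_i,t_i)\}_{i=1}^k\subset Z\times[0,\infty)$ ($k\ge1$) there exist $y\in Z$ and $\tau_1,\dots,\tau_{k-1}\in[0,\tau]$ such that, with $s_j=\sum_{i=1}^jt_i+\sum_{i=1}^{j-1}\tau_i$ and $s_0=\tau_0=0$, one has $d(f_sf_{s_{j-1}+\tau_{j-1}}y,f_sx_j)<\delta$ for all $s\in[0,t_j]$ and every $1\le j\le k$. *)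

(* Defs.v *)
From HB Require Import structures.
From Stdlib Require Import Relation_Operators.
From mathcomp Require Import all_boot all_order all_algebra generic_quotient.
From mathcomp Require Import all_classical all_reals all_analysis.

Set Implicit Arguments.
Unset Strict Implicit.
Unset Printing Implicit Defensive.

Import Order.TTheory GRing.Theory Num.Theory.
Import numFieldTopology.Exports numFieldNormedType.Exports.

Local Open Scope classical_set_scope.
Local Open Scope ring_scope.

Section Metric.
Context {R : realType}.

Definition eucl_dist (a b : R * R) : R :=
  Num.sqrt ((a.1 - b.1) ^+ 2 + (a.2 - b.2) ^+ 2).

(* [c] restricted to [0, l] is a geodesic segment of length [l] from [x] to
   [y] lying in [A]; the values of [c] outside [0, l] are irrelevant. *)
Definition geodesic_segment (X : metricType R) (A : set X)
    (c : R -> X) (l : R) (x y : X) : Prop :=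
  [/\ 0 <= l, c 0 = x, c l = y,
      forall s, `[0, l]%classic s -> A (c s) &
      forall s t, `[0, l]%classic s -> `[0, l]%classic t ->
        mdist (c s) (c t) = `|s - t|].

(* The predicates [_on A] are about [A] with the restricted metric. *)
Definition geodesic_on (X : metricType R) (A : set X) : Prop :=
  forall x y, A x -> A y -> exists c l, geodesic_segment A c l x y.

(* Side [i] of the triangle joins vertex [i] to vertex [ordS i] (cyclically).
   The comparison point of [g i s] is the point of the Euclidean segment from
   [w i] to [w (ordS i)] at distance [s] from [w i]; it is determined by its
   distances to the two endpoints. *)
Definition CAT0_on (X : metricType R) (A : set X) : Prop :=
  geodesic_on A /\
  forall (v : 'I_3 -> X) (g : 'I_3 -> R -> X) (l : 'I_3 -> R)
         (w : 'I_3 -> R * R),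
    (forall i, geodesic_segment A (g i) (l i) (v i) (v (ordS i))) ->
    (forall i, eucl_dist (w i) (w (ordS i)) = mdist (v i) (v (ordS i))) ->
    forall (i j : 'I_3) (s t : R) (a b : R * R),
      `[0, l i]%classic s -> `[0, l j]%classic t ->
      eucl_dist (w i) a = s -> eucl_dist a (w (ordS i)) = l i - s ->
      eucl_dist (w j) b = t -> eucl_dist b (w (ordS j)) = l j - t ->
      mdist (g i s) (g j t) <= eucl_dist a b.

Definition geodesic_space (X : metricType R) : Prop := geodesic_on [set: X].

Definition locally_CAT0 (X : metricType R) : Prop :=
  forall x : X, exists2 U : set X, nbhs x U & CAT0_on U.

Definition geodesic_line (X : metricType R) (g : R -> X) : Prop :=
  forall s t, mdist (g s) (g t) = `|s - t|.

Definition line_nbhd (X : metricType R) (w : R) (g : R -> X) : set X :=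
  [set x | exists t, mdist x (g t) < w].

(* [f] is an isometry of R x Y (with the l^2 product metric) onto the
   w-neighborhood of [g], and [g] is the line R x {y0}. *)
Definition has_fat_1flat (X : metricType R) : Prop :=
  exists2 g : R -> X, geodesic_line g &
  exists2 w : R, 0 < w &
  exists (Y : metricType R) (f : R * Y -> X) (y0 : Y),
    [/\ range f = line_nbhd w g,
        forall a b, mdist (f a) (f b) =
          Num.sqrt ((a.1 - b.1) ^+ 2 + mdist a.2 b.2 ^+ 2) &
        forall t, g t = f (t, y0)].

Definition is_path (T : topologicalType) (c : R -> T) (x y : T) : Prop :=
  [/\ {within `[0, 1]%classic, continuous c}, c 0 = x & c 1 = y].

Definition simply_connected (T : topologicalType) : Prop :=
  (forall x y : T, exists c, is_path c x y) /\
  (forall (x : T) (c : R -> T), is_path c x x ->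
    exists H : R * R -> T,
      {within `[0, 1]%classic `*` `[0, 1]%classic, continuous H} /\
      forall s, `[0, 1]%classic s ->
        [/\ H (s, 0) = c s, H (s, 1) = x, H (0, s) = x & H (1, s) = x]).

Definition homeomorphism_on (S T : topologicalType) (A : set S) (B : set T)
    (f : S -> T) : Prop :=
  {within A, continuous f} /\
  exists2 g : T -> S, {within B, continuous g} &
    [/\ forall x, A x -> B (f x), forall y, B y -> A (g y),
        forall x, A x -> g (f x) = x & forall y, B y -> f (g y) = y].

Definition covering_map (S T : topologicalType) (p : S -> T) : Prop :=
  [/\ continuous p, (forall y, exists x, p x = y) &
   forall y : T, exists2 U : set T, open U /\ U y &
   exists sheets : set (set S),
     [/\ forall V, sheets V -> open V /\ homeomorphism_on V U p,
         forall V W, sheets V -> sheets W -> V `&` W !=set0 -> V = W &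
         p @^-1` U = \bigcup_(V in sheets) V]].

Definition curve_length (X : metricType R) (c : R -> X) : \bar R :=
  ereal_sup [set (\sum_(0 <= i < size s)
      mdist (c (nth 1 (0 :: s) i)) (c (nth 1 (0 :: s) i.+1)))%:E
    | s in [set s : seq R | itv_partition 0 1 s]].

(* The metric of the cover is the length metric induced by [p]: the distance
   is the infimum of the lengths of the projections of the paths upstairs. *)
Definition universal_cover (X Xt : metricType R) (p : Xt -> X) : Prop :=
  [/\ simply_connected Xt, covering_map p &
   forall x y : Xt, (mdist x y)%:E =
     ereal_inf [set curve_length (p \o c) | c in [set c | is_path c x y]]].

Definition locally_isometric (X : metricType R) (g : R -> X) : Prop :=
  forall t, exists2 e : R, 0 < e & forall s u,
    `|s - t| < e -> `|u - t| < e -> mdist (g s) (g u) = `|s - u|.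

Lemma locally_isometric_shift (X : metricType R) (g : R -> X) (t : R) :
  locally_isometric g -> locally_isometric (fun s => g (s + t)).
Proof.
move=> gi r; have [e e0 H] := gi (r + t); exists e => // s u sr ur.
have E a b : (a + t) - (b + t) = a - b by rewrite opprD addrACA subrr addr0.
by rewrite H ?E.
Qed.

End Metric.

(* The cover [p] is a parameter because the metric is defined through lifts. *)
Record GX {R : realType} {X Xt : metricType R} (p : Xt -> X) : Type := MkGX {
  gx_fun :> R -> X;
  gx_loc_iso : locally_isometric gx_fun }.

Section GeodesicFlow.
Context {R : realType} {X Xt : metricType R} (p : Xt -> X).

Definition geodesic_flow (t : R) (g : GX p) : GX p :=
  MkGX p (locally_isometric_shift t (gx_loc_iso g)).

Definition is_lift (gt : R -> Xt) (g : R -> X) : Prop :=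
  continuous gt /\ forall t, p (gt t) = g t.

Definition dGX (g1 g2 : GX p) : R :=
  fine (ereal_inf [set e : \bar R | exists h1 h2 : R -> Xt,
    [/\ is_lift h1 g1, is_lift h2 g2 &
        e = (\int[lebesgue_measure]_(t in [set: R])
               (mdist (h1 t) (h2 t) * expR (- (2 * `|t|)))%:E)%E]]).

(* The topology of the metric [dGX]. It is declared from its open sets, so that
   no metric axiom (these depend on the hypotheses on [p]) is needed here. *)
Definition GX_open (U : set (GX p)) : Prop :=
  forall g, U g -> exists2 e : R, 0 < e & forall g', dGX g g' < e -> U g'.

Lemma GX_openT : GX_open setT.
Proof. by move=> g _; exists 1. Qed.

Lemma GX_openI : setI_closed GX_open.
Proof.
move=> U V oU oV g [/oU[e e0 He] /oV[d d0 Hd]].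
exists (Num.min e d); first by rewrite lt_min e0.
by move=> g'; rewrite lt_min => /andP[/He ? /Hd ?].
Qed.

Lemma GX_open_bigU (I : Type) (f : I -> set (GX p)) :
  (forall i, GX_open (f i)) -> GX_open (\bigcup_i f i).
Proof.
move=> of_ g [i _ /of_[e e0 He]].
by exists e => // g' /He ?; exists i.
Qed.

HB.instance Definition _ := gen_eqMixin (GX p).
HB.instance Definition _ := gen_choiceMixin (GX p).
HB.instance Definition _ :=
  isOpenTopological.Build (GX p) GX_openT GX_openI GX_open_bigU.

End GeodesicFlow.

Arguments geodesic_flow {R X Xt} p t g.
Arguments dGX {R X Xt} p g1 g2.
Arguments is_lift {R X Xt} p gt g.

Section Flows.
Context {R : realType}.

Definition topologically_transitive (Z : topologicalType) (f : R -> Z -> Z)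
    : Prop :=
  forall U V : set Z, open U -> open V -> U !=set0 -> V !=set0 ->
    exists2 t : R, 0 <= t & (f t @` U) `&` V !=set0.

(* The data x_i, t_i (1 <= i <= k) and tau_i (0 <= i <= k - 1) are given by
   sequences of which only these terms matter. *)
Definition weak_specification (Z : Type) (d : Z -> Z -> R) (f : R -> Z -> Z)
    : Prop :=
  forall delta : R, 0 < delta -> exists2 tau : R, 0 < tau &
  forall (k : nat) (x : nat -> Z) (t : nat -> R), (1 <= k)%N ->
    (forall i, (1 <= i <= k)%N -> 0 <= t i) ->
    exists (y : Z) (taus : nat -> R),
      [/\ taus 0%N = 0,
          forall i, (1 <= i < k)%N -> 0 <= taus i <= tau &
          let S j := \sum_(1 <= i < j.+1) t i + \sum_(1 <= i < j) taus i in
          forall j, (1 <= j <= k)%N -> forall s, 0 <= s <= t j ->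
            d (f s (f (S j.-1 + taus j.-1) y)) (f s (x j)) < delta].

Definition orbit (Z : Type) (f : R -> Z -> Z) (z : Z) : set Z :=
  [set f s z | s in [set: R]].

(* Orbits carry the topology and orientation of their parametrization by time
   (not the subspace topology, for which a non-periodic orbit need not be a
   1-manifold). Near each point [z] of an orbit, [h] is injective along the
   orbit and is an increasing homeomorphism [a] in the time parameters. *)
Definition orbit_semi_equivalence (Z1 Z2 : topologicalType)
    (f : R -> Z1 -> Z1) (g : R -> Z2 -> Z2) (h : Z1 -> Z2) : Prop :=
  [/\ continuous h, (forall y, exists x, h x = y) &
   forall z : Z1, h @` orbit f z = orbit g (h z) /\
   exists (e : R) (a : R -> R), 0 < e /\
     [/\ a 0 = 0,
         {within `]- e, e[%classic, continuous a},
         {in `]- e, e[ &, {homo a : s t / s < t}},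
         {in `]- e, e[, forall s, h (f s z) = g (a s) (h z)} &
         {in `]- e, e[ &, forall s t, h (f s z) = h (f t z) -> f s z = f t z}]].

End Flows.

Section SFT.
Context (A : finType).

Definition full_shift : Type := {ptws int -> discrete_topology A}.
HB.instance Definition _ := Topological.on full_shift.

(* [shiftZ n] is the n-th power of the left shift [shiftZ 1]. *)
Definition shiftZ (n : int) (x : full_shift) : full_shift := fun k => x (k + n).

Definition occurs_at (w : seq A) (x : full_shift) (k : int) : Prop :=
  forall i : 'I_(size w), x (k + i%:Z) = tnth (in_tuple w) i.

Definition SFT (F : seq (seq A)) : set full_shift :=
  [set x | forall w, w \in F -> forall k, ~ occurs_at w x k].

Lemma shiftZ_SFT F n x : SFT F x -> SFT F (shiftZ n x).
Proof.
move=> Fx w wF k wk; apply: (Fx w wF (k + n)) => i.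
by rewrite -wk /shiftZ addrAC.
Qed.

Definition SFT_shift (F : seq (seq A)) (n : int) (x : SFT F) : SFT F :=
  exist _ (shiftZ n (\val x)) (mem_set (shiftZ_SFT (n := n) (set_valP x))).

End SFT.

Section Suspension.
Local Open Scope quotient_scope.
Context (R : realType) (A : finType) (F : seq (seq A)).

Definition unit_itv : Type := set_type (`[0, 1]%classic : set R).
HB.instance Definition _ := Topological.on unit_itv.

Definition box : Type := (SFT F * unit_itv)%type.
HB.instance Definition _ := Topological.on box.

Definition glue (u v : box) : Prop :=
  [/\ \val u.2 = 1, \val v.2 = 0 & v.1 = SFT_shift 1 u.1].

Definition susp_rel (u v : box) : bool := `[< clos_refl_sym_trans box glue u v >].

Lemma susp_rel_refl : reflexive susp_rel.
Proof. by move=> u; apply/asboolP; exact: rst_refl. Qed.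

Lemma susp_rel_sym : symmetric susp_rel.
Proof. by move=> u v; apply/asboolP/asboolP => ?; exact: rst_sym. Qed.

Lemma susp_rel_trans : transitive susp_rel.
Proof.
by move=> v u w /asboolP uv /asboolP vw; apply/asboolP; exact: rst_trans uv vw.
Qed.

Definition susp_eqv := EquivRel susp_rel susp_rel_refl susp_rel_sym susp_rel_trans.

Definition Susp : Type := quotient_topology {eq_quot susp_eqv}.
HB.instance Definition _ := Topological.on Susp.
HB.instance Definition _ := Quotient.on Susp.

Lemma frac_in01 (r : R) : `[0, 1]%classic (r - (Num.floor r)%:~R).
Proof.
have /andP[h1 h2] := floor_itv (r : R).
rewrite /= in_itv /= subr_ge0 h1 /= lerBlDl; apply: ltW.
by rewrite intrD in h2.
Qed.

Definition frac (r : R) : unit_itv :=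
  exist (fun x => x \in (`[0, 1]%classic : set R)) _ (mem_set (frac_in01 r)).

(* Moving up by [t] from height [s] crosses the roof floor(s + t) times. *)
Definition box_flow (t : R) (u : box) : box :=
  (SFT_shift (Num.floor (\val u.2 + t)) u.1, frac (\val u.2 + t)).

Definition susp_flow (t : R) (z : Susp) : Susp :=
  \pi_Susp (box_flow t (repr z)).

Lemma box_flow_glue (t : R) (u v : box) :
  glue u v -> box_flow t u = box_flow t v.
Proof.
case: u v => [x s] [y r] [/= s1 r0 yE]; rewrite /box_flow /= s1 r0 yE.
have fE : Num.floor (1 + t) = 1 + Num.floor (0 + t).
  by rewrite add0r floorDzr ?rpred1 // floor1.
apply: (congr2 pair); apply: val_inj; rewrite /= fE.
  by rewrite /shiftZ; apply/funext => k; rewrite addrA addrAC.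
by rewrite add0r intrD opprD addrACA subrr add0r.
Qed.

Lemma susp_flow_pi (t : R) (u : box) :
  susp_flow t (\pi_Susp u) = \pi_Susp (box_flow t u).
Proof.
rewrite /susp_flow.
have /eqmodP/asboolP : repr (\pi_Susp u) = u %[mod {eq_quot susp_eqv}].
  exact: (reprK (\pi_Susp u)).
move: (repr _) => v; elim=> {u v} [a b ab|//|a b _ -> //|a b c _ -> _ -> //].
by rewrite (box_flow_glue t ab).
Qed.

Lemma susp_flow_local (t : R) (x : SFT F) (s r : unit_itv) :
  \val r = \val s + t ->
  susp_flow t (\pi_Susp ((x, s) : box)) = \pi_Susp ((x, r) : box).
Proof.
move=> rE; rewrite susp_flow_pi /box_flow /= -rE.
have /= := set_valP r; rewrite in_itv /= => /andP[r0].
rewrite le_eqVlt => /predU1P[r1|r1].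
  apply/esym/eqmodP/asboolP/rst_step; split=> //=.
    by rewrite r1 floor1 subrr.
  by rewrite r1 floor1.
have f0 : Num.floor (\val r) = 0 by apply: floor_def; rewrite r0 add0r.
congr (\pi_Susp _); apply: (congr2 pair); apply: val_inj; rewrite /= f0 ?subr0 //.
by apply/funext => k; rewrite /shiftZ addr0.
Qed.

End Suspension.

Arguments susp_flow : clear implicits.

(* Main.v *)
Require Import Defs.
From Stdlib Require Import Relation_Operators.
From mathcomp Require Import all_boot all_order all_algebra generic_quotient.
From mathcomp Require Import all_classical all_reals all_analysis.
From mathcomp Require Import measurable_realfun.
From mathcomp Require Import ring lra zify.

Set Implicit Arguments.
Unset Strict Implicit.
Unset Printing Implicit Defensive.

Import Order.TTheory GRing.Theory Num.Theory.
Import numFieldTopology.Exports numFieldNormedType.Exports.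

Local Open Scope classical_set_scope.
Local Open Scope ring_scope.

(** Why the theorem holds. Let [g] be the axis of the fat flat in the universal
    cover. The geometric input is elementary: when the [w]-neighborhood of [g]
    is a metric product [R x Y], a local geodesic inside it has an affine first
    coordinate, of slope [v] say, and a second coordinate that is Lipschitz with
    constant [sqrt (1 - v ^ 2)] ([product_geodesic_affine],
    [fat_line_coordinates]). This uses only the equality case of Minkowski's
    inequality, for an arbitrary metric space [Y]. Geodesics are transferred
    between [X] and its cover by means of a uniform scale, obtained by
    compactness, below which the covering map is isometric
    ([injectivity_radius_exists]); closeness for [dGX] gives closeness in [X]
    at all times of a compact interval ([dGX_uniform]).

    Weak specification. A geodesic shadowing [g] during a time [T] has slope
    close to 1, with a defect of order [1 / T], so it diverges from [g] at speed
    of order [T ^ (-1/2)] and continues to shadow [g] during any prescribed time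
    when [T] is large ([fat_line_shadowing_extends]). Specification with a
    bounded gap would make it shadow next the line [g] run backwards, over an
    interval of time in which the two motions meet; but two lifts that meet
    and run in opposite directions separate ([opposite_lines_diverge]).

    Symbolic coding. The limit case of the same estimate says that a local
    geodesic asymptotic to a fat line, up to a change of time, is a translate of
    it ([asymptotic_to_fat_line]). Given an orbit semi-equivalence [h],
    transitivity and compactness give points [x1] and [x2] of the subshift whose
    leaves are translates of [g] and of [g] reversed, together with arbitrarily good connections
    from [x1] to [x2] ([transitive_connection]). Since the subshift is of finite
    type, some point [x] has the past of [x1] and the future of [x2]
    ([SFT_splice]). The leaf of [x] is asymptotic to [g] in the past, so it is a
    translate of [g]; the reverse of [g] is asymptotic to this leaf in the
    future, so it is also a translate of [g]. But no translate of [g] coincides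
    in [X] with the reverse of [g], again by [opposite_lines_diverge]. The
    changes of time along orbits are controlled by compactness: crossing the
    suspension once takes a time bounded below ([time_piece_lower_bound]). *)

(* [lra] without the quantified hypotheses, which only slow it down. *)
Ltac llra := repeat match goal with H : (forall _, _) |- _ => clear H end; lra.

(** * Real induction and geodesics of metric products *)

Section RealInduction.
Context {R : realType}.

(** A property that propagates to the right inside a neighborhood of each point
    of [a, b] passes from [a] to [b]. *)
Lemma real_induction (a b : R) (P : R -> Prop) : a <= b -> P a ->
  (forall t, a <= t <= b -> exists2 e : R, 0 < e &
     forall s u, a <= s <= t -> t <= u <= b -> t - e < s -> u < t + e ->
       P s -> P u) ->
  P b.
Proof.
move=> ab Pa step.
pose S := [set u | a <= u <= b /\ P u].
have Sa : S a by split=> //; rewrite lexx.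
have Sb : ubound S b by move=> u [/andP[]].
have hS : has_sup S by split; [exists a|exists b].
have amb : a <= sup S <= b.
  by rewrite (sup_upper_bound hS)//=; apply: ge_sup => //; exists a.
have [e e0 He] := step _ amb.
have [s Ss lts] := sup_adherent e0 hS.
have sm : s <= sup S by exact: sup_upper_bound.
have [/andP[sa sb] Ps] := Ss.
pose u := Num.min b (sup S + e / 2).
have /andP[am mb] := amb.
have mu : sup S <= u by rewrite /u le_min mb /=; lra.
have ub : u <= b by rewrite /u ge_min lexx.
have ult : u < sup S + e.
  by rewrite /u gt_min; apply/orP; right; lra.
have Pu : P u by apply: (He s u) => //; apply/andP; split=> //.
have Su : S u by split=> //; apply/andP; split=> //; lra.
have um : u <= sup S by exact: sup_upper_bound.
suff -> : b = u by [].
apply/eqP; rewrite eq_le ub andbT leNgt; apply/negP => lub.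
have ue : u = sup S + e / 2.
  by move: lub; rewrite /u; case: (leP b (sup S + e / 2)) => //; rewrite ltxx.
by lra.
Qed.

End RealInduction.

Section ProductGeodesics.
Context {R : realType}.

(** The equality case of Minkowski's inequality: increments [(A1, B1)] and
    [(A2, B2)] of lengths [x] and [y] whose sum has length [x + y] are parallel. *)
Lemma proportional_of_minkowski_eq (x y A1 A2 B1 B2 B : R) :
  0 < x -> 0 < y -> 0 <= B -> 0 <= B1 -> 0 <= B2 -> B <= B1 + B2 ->
  A1 ^+ 2 + B1 ^+ 2 = x ^+ 2 -> A2 ^+ 2 + B2 ^+ 2 = y ^+ 2 ->
  (A1 + A2) ^+ 2 + B ^+ 2 = (x + y) ^+ 2 ->
  A1 * y = A2 * x.
Proof.
move=> x0 y0 B0 B10 B20 BB e1 e2 e3.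
have xy0 : 0 < x * y by apply: mulr_gt0.
have BB2 : B ^+ 2 <= (B1 + B2) ^+ 2 by rewrite lerXn2r ?nnegrE//; lra.
have h1 : x * y <= A1 * A2 + B1 * B2 by nra.
have h2 : (A1 * A2 + B1 * B2) ^+ 2 + (A1 * B2 - A2 * B1) ^+ 2 = (x * y) ^+ 2.
  by rewrite exprMn -e1 -e2; ring.
have h3 : (x * y) ^+ 2 <= (A1 * A2 + B1 * B2) ^+ 2.
  by rewrite lerXn2r ?nnegrE//; lra.
have h4 : (A1 * B2 - A2 * B1) ^+ 2 <= 0 by lra.
have h5 : A1 * B2 - A2 * B1 = 0.
  by apply/eqP; rewrite -sqrf_eq0 eq_le h4 sqr_ge0.
have h6 : (A1 * A2 + B1 * B2) ^+ 2 = (x * y) ^+ 2 by rewrite -h2 h5; ring.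
have h7 : A1 * A2 + B1 * B2 = x * y.
  apply/eqP; rewrite -(@eqrXn2 _ 2)//; first by rewrite h6.
  - by lra.
  - by lra.
have yn : y != 0 by rewrite gt_eqF.
apply: (mulIf yn).
have -> : A1 * y * y = A1 * (y ^+ 2) by ring.
rewrite -e2; have -> : A2 * x * y = A2 * (x * y) by ring.
rewrite -h7.
have : B2 * (A1 * B2 - A2 * B1) = 0 by rewrite h5 mulr0.
by move=> H; apply/eqP; rewrite -subr_eq0; apply/eqP; rewrite -H; ring.
Qed.

(** A local geodesic of the product of the real line and a metric space [Y] has
    an affine first coordinate, and a second coordinate whose speed is bounded
    accordingly. *)
Lemma product_geodesic_affine (Y : metricType R) (a b : R) (q : R -> R * Y) : a < b ->
  (forall t, a <= t <= b -> exists2 e : R, 0 < e &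
     forall s u, a <= s <= b -> a <= u <= b -> `|s - t| < e -> `|u - t| < e ->
       ((q s).1 - (q u).1) ^+ 2 + mdist (q s).2 (q u).2 ^+ 2 = (s - u) ^+ 2) ->
  exists2 v : R, v ^+ 2 <= 1 &
    forall s u, a <= s -> s <= u -> u <= b ->
      (q u).1 - (q s).1 = v * (u - s) /\
      mdist (q s).2 (q u).2 <= Num.sqrt (1 - v ^+ 2) * (u - s).
Proof.
move=> ab loc.
(* near [t], increments over adjacent intervals are proportional to their
   lengths *)
have three t e s1 s2 s3 : a <= t <= b -> 0 < e ->
    (forall s u, a <= s <= b -> a <= u <= b -> `|s - t| < e -> `|u - t| < e ->
       ((q s).1 - (q u).1) ^+ 2 + mdist (q s).2 (q u).2 ^+ 2 = (s - u) ^+ 2) ->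
    a <= s1 -> s1 < s2 -> s2 < s3 -> s3 <= b -> t - e < s1 -> s3 < t + e ->
    ((q s2).1 - (q s1).1) * (s3 - s2) = ((q s3).1 - (q s2).1) * (s2 - s1).
  move=> tab e0 He as1 s12 s23 s3b tes1 s3te.
  have H s u : a <= s -> s <= b -> a <= u -> u <= b -> t - e < s -> s < t + e ->
      t - e < u -> u < t + e ->
      ((q u).1 - (q s).1) ^+ 2 + mdist (q s).2 (q u).2 ^+ 2 = (u - s) ^+ 2.
    move=> ? ? ? ? ? ? ? ?.
    rewrite -[in LHS](sqrrN (_ - _)) opprB -[RHS]sqrrN opprB; apply: He.
    - by apply/andP.
    - by apply/andP.
    - by rewrite ltr_norml; apply/andP; split; llra.
    - by rewrite ltr_norml; apply/andP; split; llra.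
  apply: (@proportional_of_minkowski_eq _ _ _ _ (mdist (q s1).2 (q s2).2)
     (mdist (q s2).2 (q s3).2) (mdist (q s1).2 (q s3).2)); rewrite ?mdist_ge0//.
  - llra.
  - llra.
  - exact: metric_triangle.
  - by apply: H; llra.
  - by apply: H; llra.
  - have -> : s2 - s1 + (s3 - s2) = s3 - s1 by ring.
    have -> : (q s2).1 - (q s1).1 + ((q s3).1 - (q s2).1) = (q s3).1 - (q s1).1
      by ring.
    by apply: H; llra.
(* hence the first coordinate lies on one line near [t] *)
have lin t e x y s : a <= t <= b -> 0 < e ->
    (forall s u, a <= s <= b -> a <= u <= b -> `|s - t| < e -> `|u - t| < e ->
       ((q s).1 - (q u).1) ^+ 2 + mdist (q s).2 (q u).2 ^+ 2 = (s - u) ^+ 2) ->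
    a <= x -> x < y -> y <= b -> t - e < x -> y < t + e ->
    a <= s -> s <= b -> t - e < s -> s < t + e ->
    ((q s).1 - (q x).1) * (y - x) = ((q y).1 - (q x).1) * (s - x).
  move=> tab e0 He ax xy yb tex yte sa sb tes ste.
  have [->|sx] := eqVneq s x; first by rewrite !subrr mul0r mulr0.
  have [->|sy] := eqVneq s y; first by [].
  have [ltsx|lexs] := ltP s x.
    have := three t e s x y tab e0 He sa ltsx xy yb tes yte; llra.
  have ltxs : x < s by rewrite lt_neqAle eq_sym sx.
  have [ltsy|leys] := ltP s y.
    have := three t e x s y tab e0 He ax ltxs ltsy yb tex yte; llra.
  have ltys : y < s by rewrite lt_neqAle eq_sym sy.
  have := three t e x y s tab e0 He ax xy ltys sb tex ste; llra.
have aab : a <= a <= b by rewrite lexx ltW.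
have [e0 e0p He0] := loc a aab.
pose a1 := Num.min b (a + e0 / 2).
have a1b : a1 <= b by rewrite /a1 ge_min lexx.
have aa1 : a < a1 by rewrite /a1 lt_min ab /=; llra.
have a1e : a1 < a + e0 by rewrite /a1 gt_min; apply/orP; right; llra.
pose v := ((q a1).1 - (q a).1) / (a1 - a).
have a1a : a1 - a != 0 by rewrite subr_eq0 gt_eqF.
(* real induction starts at [a1 > a], so that the part of [a, s] already
   treated always overlaps the window in an interval, which fixes the slope *)
have line : forall u, a <= u -> u <= b -> (q u).1 = (q a).1 + v * (u - a).
  suff H : forall s, a <= s <= b -> (q s).1 = (q a).1 + v * (s - a).
    by move=> u ua ub; apply: H; apply/andP.
  pose P w := forall s, a <= s <= w -> (q s).1 = (q a).1 + v * (s - a).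
  suff : P b by [].
  apply: (@real_induction _ a1 b P) => //.
    move=> s /andP[sa sa1].
    have h : ((q s).1 - (q a).1) * (a1 - a) = ((q a1).1 - (q a).1) * (s - a).
      by apply: (lin a e0 a a1 s aab e0p He0); llra.
    have : (q s).1 - (q a).1 = v * (s - a).
      by apply: (mulIf a1a); rewrite h /v; field.
    llra.
  move=> t /andP[a1t tb].
  have tab : a <= t <= b by apply/andP; split; llra.
  have [e e0' He] := loc t tab; exists e => // s u /andP[a1s st] /andP[tu ub] tes ute Ps.
  move=> w /andP[aw wu].
  have [ws|sw] := leP w s; first by apply: Ps; apply/andP.
  pose x := Num.max a ((t - e + s) / 2).
  have ax : a <= x by rewrite /x le_max lexx.
  have xs : x < s by rewrite /x gt_max; apply/andP; split; llra.
  have tex : t - e < x by rewrite /x lt_max; apply/orP; right; llra.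
  have Px : (q x).1 = (q a).1 + v * (x - a) by apply: Ps; apply/andP; split; llra.
  have Pss : (q s).1 = (q a).1 + v * (s - a) by apply: Ps; apply/andP; split; llra.
  have h : ((q w).1 - (q x).1) * (s - x) = ((q s).1 - (q x).1) * (w - x).
    by apply: (lin t e x s w tab e0' He); llra.
  have sx : s - x != 0 by rewrite subr_eq0 gt_eqF.
  have : (q w).1 - (q x).1 = v * (w - x).
    by apply: (mulIf sx); rewrite h Px Pss; ring.
  by rewrite Px; llra.
have diff s u : a <= s -> s <= b -> a <= u -> u <= b ->
    (q u).1 - (q s).1 = v * (u - s).
  by move=> ? ? ? ?; rewrite (line u)// (line s)//; ring.
have v1 : v ^+ 2 <= 1.
  have := He0 a a1 aab; rewrite subrr normr0 => /(_ _ e0p).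
  have -> : a <= a1 <= b by apply/andP; split; llra.
  move=> /(_ isT); have -> : `|a1 - a| < e0.
    by rewrite ltr_norml; apply/andP; split; llra.
  move=> /(_ isT) h.
  have := diff a1 a (ltW aa1) a1b (lexx _) (ltW ab) => h2.
  have := sqr_ge0 (mdist (q a).2 (q a1).2) => h3.
  rewrite h2 in h; have h4 : 0 < (a - a1) ^+ 2.
    by rewrite exprn_even_gt0//= subr_eq0 lt_eqF.
  rewrite -(ler_pM2r h4) mul1r; llra.
exists v => // s u sa su ub; split; first by apply: diff; llra.
pose P w := mdist (q s).2 (q w).2 <= Num.sqrt (1 - v ^+ 2) * (w - s).
suff : P u by [].
apply: (@real_induction _ s u P) => //.
  by rewrite /P mdistxx subrr mulr0.
move=> t /andP[st tu]; have tab : a <= t <= b by apply/andP; split; llra.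
have [e e0' He] := loc t tab; exists e => // w z /andP[sw wt] /andP[tz zu] tew zte.
rewrite /P => Pw.
apply: (le_trans (metric_triangle _ (q w).2 _)).
have -> : z - s = (w - s) + (z - w) by ring.
rewrite mulrDr lerD//.
have h := He w z.
have {}h : ((q w).1 - (q z).1) ^+ 2 + mdist (q w).2 (q z).2 ^+ 2 = (w - z) ^+ 2.
  by apply: h; rewrite ?ltr_norml; apply/andP; split; llra.
have h2 : mdist (q w).2 (q z).2 ^+ 2 = (1 - v ^+ 2) * (z - w) ^+ 2.
  by move: h; have -> : (q w).1 - (q z).1 = v * (w - z) by [apply: diff; llra]; llra.
have zw : 0 <= z - w by llra.
rewrite -(ger0_norm (mdist_ge0 _ _)) -sqrtr_sqr h2 sqrtrM ?sqrtr_sqr ?ger0_norm//.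
by llra.
Qed.

End ProductGeodesics.

(** * Paths in metric spaces and their length *)

Section MetricPaths.
Context {R : realType}.
Implicit Types X Y : metricType R.

(** Continuity on [a, b] in epsilon-delta form. *)
Definition continuous_on X (a b : R) (c : R -> X) : Prop :=
  forall t, a <= t <= b -> forall eps, 0 < eps -> exists2 e : R, 0 < e &
    forall s, a <= s <= b -> `|s - t| < e -> mdist (c s) (c t) < eps.

Lemma nbhs_mdist X (x : X) (A : set X) :
  nbhs x A <-> exists2 e : R, 0 < e & forall y, mdist x y < e -> A y.
Proof.
split=> [/nbhs_ballP[e e0 He]|[e e0 He]].
  by exists e => // y xy; apply: He; rewrite ballEmdist.
by apply/nbhs_ballP; exists e => // y; rewrite ballEmdist; exact: He.
Qed.

Lemma open_mdist X (A : set X) x : open A -> A x ->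
  exists2 e : R, 0 < e & forall y, mdist x y < e -> A y.
Proof. by move=> oA Ax; apply/nbhs_mdist; exact: open_nbhs_nbhs. Qed.

Lemma nbhs_real (t : R) (A : set R) :
  nbhs t A <-> exists2 e : R, 0 < e & forall s, `|s - t| < e -> A s.
Proof.
split=> [/nbhs_ballP[e e0 He]|[e e0 He]].
  by exists e => // y xy; apply: He; rewrite /ball/= distrC.
by apply/nbhs_ballP; exists e => // y; rewrite /ball/= distrC; exact: He.
Qed.

Lemma set_itvccP (a b s : R) : `[a, b]%classic s <-> a <= s <= b.
Proof. by rewrite /= in_itv. Qed.

Lemma within_continuous_on X (a b : R) (c : R -> X) :
  {within `[a, b]%classic, continuous c} <-> continuous_on a b c.
Proof.
rewrite subspace_continuousP; split=> H t tab.
- move=> eps eps0.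
  have tab' : `[a, b]%classic t by apply/set_itvccP.
  have : nbhs (c t) [set y | mdist (c t) y < eps] by apply/nbhs_mdist; exists eps.
  move=> /(H t tab'); rewrite /nbhs/= /within/= => /nbhs_real[e e0 He].
  exists e => // s sab st; rewrite metric_sym; apply: He => //.
- move=> A /nbhs_mdist[eps eps0 He].
  have tab' : a <= t <= b by exact/set_itvccP.
  have [e e0 Hd] := H t tab' eps eps0.
  apply/nbhs_real; exists e => // s st /set_itvccP sab.
  by apply: He; rewrite metric_sym; exact: Hd.
Qed.

(** A map is 1-Lipschitz as soon as it is so near each parameter. *)
Lemma lipschitz_of_local X (a b : R) (c : R -> X) : a <= b ->
  (forall t, a <= t <= b -> exists2 e : R, 0 < e & forall s u,
     t - e < s -> s <= u -> u < t + e -> a <= s -> u <= b ->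
     mdist (c s) (c u) <= u - s) ->
  mdist (c a) (c b) <= b - a.
Proof.
move=> ab loc; pose P u := mdist (c a) (c u) <= u - a.
suff : P b by [].
apply: (@real_induction _ a b P) => //; first by rewrite /P mdistxx subrr.
move=> t tab; have [e e0 He] := loc t tab.
exists e => // s u /andP[as_ st] /andP[tu ub] tes ute; rewrite /P => Ps.
apply: (le_trans (metric_triangle _ (c s) _)).
have := He s u tes (le_trans st tu) ute as_ ub; llra.
Qed.

Lemma locally_isometric_lipschitz X (g : R -> X) s t :
  locally_isometric g -> mdist (g s) (g t) <= `|s - t|.
Proof.
move=> gi; wlog st : s t / s <= t => [H|].
  by have [/H//|/ltW/H] := leP s t; rewrite metric_sym distrC.
rewrite distrC ger0_norm ?subr_ge0//.
apply: lipschitz_of_local => // u _; have [e e0 He] := gi u.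
exists e => // x y ux xy yu _ _; rewrite He.
- by rewrite distrC ger0_norm ?subr_ge0.
- by rewrite ltr_norml; apply/andP; split; llra.
- by rewrite ltr_norml; apply/andP; split; llra.
Qed.

Lemma locally_isometric_reverse X (g : R -> X) :
  locally_isometric g -> locally_isometric (fun s => g (- s)).
Proof.
move=> gi t; have [e e0 H] := gi (- t); exists e => // s u st ut.
have E (a b : R) : - a - - b = - (a - b) by ring.
by rewrite H ?E ?normrN.
Qed.

Lemma curve_length_ge X (c : R -> X) :
  ((mdist (c 0) (c 1))%:E <= curve_length c)%E.
Proof.
apply: ereal_sup_ubound; exists [:: 1].
  by rewrite /itv_partition/=; split; rewrite ?ltr01//=.
by rewrite /= big_nat1.
Qed.

(** The length of a curve bounds the distance from its origin to its points. *)
Lemma curve_length_ge_at X (c : R -> X) t : 0 <= t <= 1 ->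
  ((mdist (c 0) (c t))%:E <= curve_length c)%E.
Proof.
rewrite le_eqVlt => /andP[/predU1P[<- _|t0]].
  by apply: le_trans (curve_length_ge c); rewrite mdistxx lee_fin mdist_ge0.
rewrite le_eqVlt => /predU1P[->|t1]; first exact: curve_length_ge.
apply: (@le_trans _ _ (mdist (c 0) (c t) + mdist (c t) (c 1))%:E).
  by rewrite lee_fin lerDl mdist_ge0.
apply: ereal_sup_ubound; exists [:: t; 1].
  by rewrite /itv_partition/=; split; rewrite ?t0 ?t1//=.
by rewrite /= big_nat_recl//= big_nat1.
Qed.

(** A geodesic parametrized on [0, 1] at speed [l] has length at most [l]. *)
Lemma curve_length_geodesic X (c : R -> X) (l : R) :
  (forall s t, 0 <= s -> s <= t -> t <= 1 -> mdist (c s) (c t) = l * (t - s)) ->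
  (curve_length c <= l%:E)%E.
Proof.
move=> H; apply: ge_ereal_sup => _ [s [sp /eqP sl] <-].
rewrite lee_fin.
suff K : forall a, 0 <= a -> path <%R a s -> last a s <= 1 ->
   \sum_(0 <= i < size s)
     mdist (c (nth 1 (a :: s) i)) (c (nth 1 (a :: s) i.+1)) = l * (last a s - a).
  by rewrite K// ?sl// subr0 mulr1.
elim: s {sp sl} => [|x s IH] a a0 /=.
  by rewrite big_geq// subrr mulr0.
move=> /andP[ax xs] l1; rewrite big_nat_recl//= IH//; last first.
  by apply: le_trans a0 _; exact: ltW.
have xl : x <= last x s.
  by apply: (@itv_partition_le _ _ x (last x s) s); split.
rewrite H ?(ltW ax)//; first by ring.
exact: le_trans xl l1.
Qed.

End MetricPaths.

(** * Uniform scale of the covering map *)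

Section Covering.
Context {R : realType} {X Xt : metricType R} (p : Xt -> X).

(** The preimage of [U] is a disjoint union of open sets homeomorphic to [U]. *)
Definition evenly_covered (U : set X) : Prop :=
  exists sheets : set (set Xt),
     [/\ forall V, sheets V -> open V /\ homeomorphism_on V U p,
         forall V W, sheets V -> sheets W -> V `&` W !=set0 -> V = W &
         p @^-1` U = \bigcup_(V in sheets) V].

(** By compactness, for some [rho] every ball of radius [rho] is contained in an
    evenly covered set. *)
Lemma lebesgue_number_covering : compact [set: X] -> covering_map p ->
  exists2 rho : R, 0 < rho &
    forall x : X, exists2 U, evenly_covered U & forall y, mdist x y < rho -> U y.
Proof.
move=> cX [_ _ cov].
pose P (r : R) (x : X) :=
  exists2 U, evenly_covered U & forall y, mdist x y < r -> U y.
have /compact_near_coveringP/(_ R (0^'+) P) := cX.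
have H : forall x : X, [set: X] x -> \forall x' \near x & r \near 0^'+, P r x'.
  move=> x _; have [U [oU Ux] [sh Hsh]] := cov x.
  have [e e0 He] := open_mdist oU Ux.
  exists ([set y | mdist x y < e / 2], [set r : R | r < e / 2]) => /=.
    split; first by apply/nbhs_mdist; exists (e / 2) => //; llra.
    by apply: nbhs_right_lt; llra.
  move=> [x' r] [/= xx' re]; exists U; first by exists sh.
  move=> y x'y; apply: He; apply: le_lt_trans (metric_triangle _ x' _) _; llra.
move=> /(_ _ H) K.
have [r [r0 Hr]] := filter_ex (filterI (nbhs_right_gt (0 : R)) K).
by exists r => // x; exact: (Hr x).
Qed.
End Covering.

Section InjectivityRadius.
Context {R : realType} {X Xt : metricType R} (p : Xt -> X).

(** Below the scale [rho], [p] is isometric and every point near the image of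
    [x] has a preimage at the same distance from [x]. *)
Definition injectivity_radius (rho : R) : Prop :=
  [/\ 0 < rho,
      forall x y, mdist (p x) y < rho ->
        exists2 z, p z = y & mdist x z = mdist (p x) y &
      forall x y, mdist x y < rho -> mdist (p x) (p y) = mdist x y].

Lemma universal_cover_lipschitz x y :
  universal_cover p -> mdist (p x) (p y) <= mdist x y.
Proof.
move=> [_ _ pm]; rewrite -lee_fin pm; apply: le_ereal_inf_tmp => _ [c [cc c0 c1] <-].
by rewrite -c0 -c1; exact: (curve_length_ge (p \o c)).
Qed.

(** A path over an evenly covered set does not leave its sheet. *)
Lemma path_in_sheet (U : set X) (sheets : set (set Xt)) (V : set Xt)
    (c : R -> Xt) :
  (forall W, sheets W -> open W) ->
  (forall W W', sheets W -> sheets W' -> W `&` W' !=set0 -> W = W') ->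
  p @^-1` U = \bigcup_(W in sheets) W ->
  sheets V -> continuous_on 0 1 c ->
  (forall t, 0 <= t <= 1 -> U (p (c t))) -> V (c 0) -> V (c 1).
Proof.
move=> so disj pU sV cc cU V0; pose P t := V (c t).
suff : P 1 by [].
apply: (@real_induction _ 0 1 P) => // t t01.
have : (p @^-1` U) (c t) by exact: cU.
rewrite pU => -[W sW Wct].
have [d d0 Hd] := open_mdist (so _ sW) Wct.
have [e e0 He] := cc t t01 _ d0; exists e => // s u /andP[s0 st] /andP[tu u1] tes ute Ps.
have near_t r : 0 <= r -> r <= 1 -> t - e < r -> r < t + e -> W (c r).
  move=> ? ? ? ?; apply: Hd; rewrite metric_sym; apply: He; first exact/andP.
  by rewrite ltr_norml; apply/andP; split; llra.
have Ws : W (c s) by apply: near_t; llra.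
rewrite /P; have -> : V = W by apply: disj => //; exists (c s).
by apply: near_t; llra.
Qed.

(** A short geodesic of [X] lifts into a sheet, so points of one sheet are at
    most as far apart as their images; and two points at distance less than
    [rho] lie in the same sheet, as a short path joins them. *)
Lemma injectivity_radius_exists :
  compact [set: X] -> geodesic_space X -> universal_cover p ->
  exists rho, injectivity_radius rho.
Proof.
move=> cX gX uc; have [_ cov pm] := uc.
have [rho rho0 Hrho] := lebesgue_number_covering cX cov.
have lift x (U : set X) (V : set Xt) (k : X -> Xt) :
    (forall y, mdist (p x) y < rho -> U y) -> V x ->
    {within U, continuous k} -> (forall z, V z -> k (p z) = z) ->
    (forall y, U y -> p (k y) = y) ->
    forall y, mdist (p x) y < rho -> mdist x (k y) = mdist (p x) y.
  move=> HU Vx kc kp pk y py.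
  apply/eqP; rewrite eq_le; apply/andP; split; last first.
    by have := universal_cover_lipschitz x (k y) uc; rewrite (pk y (HU y py)).
  have [c [l [l0 c0 cl _ cg]]] := gX (p x) y I I.
  have ci s : 0 <= s -> s <= l -> `[0, l]%classic s by move=> *; apply/set_itvccP/andP.
  have lE : l = mdist (p x) y.
    by rewrite -c0 -cl cg ?sub0r ?normrN ?ger0_norm//; apply: ci.
  have sl s : 0 <= s -> s <= 1 -> 0 <= l * s /\ l * s <= l.
    move=> s0 s1; split; first exact: mulr_ge0.
    by rewrite ler_piMr.
  have cU s : 0 <= s -> s <= 1 -> U (c (l * s)).
    move=> s0 s1; have [ls0 lsl] := sl s s0 s1.
    apply: HU; rewrite -{1}c0 cg//; try exact: ci.
    by rewrite sub0r normrN ger0_norm//; apply: le_lt_trans lsl _; rewrite lE.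
  rewrite -lee_fin pm -lE.
  pose b s := k (c (l * s)).
  apply: (@le_trans _ _ (curve_length (p \o b))).
    apply: ereal_inf_lbound; exists b => //; split.
    - apply/within_continuous_on => t /andP[t0 t1] eps eps0.
      have Ut := cU t t0 t1.
      move/subspace_continuousP : kc => /(_ _ Ut).
      move=> /(_ [set z | mdist (b t) z < eps]).
      have : nbhs (k (c (l * t))) [set z | mdist (b t) z < eps].
        by apply/nbhs_mdist; exists eps.
      move=> /[swap] /[apply]; rewrite /nbhs/= /within/= => /nbhs_mdist[e e0 He].
      exists (e / (l + 1)); first by apply: divr_gt0 => //; llra.
      move=> s /andP[s0 s1] st; rewrite metric_sym; apply: He; last exact: cU.
      have [lt0 ltl] := sl t t0 t1; have [ls0 lsl] := sl s s0 s1.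
      rewrite cg; try by apply: ci.
      rewrite -mulrBr normrM (ger0_norm l0) distrC.
      have l1 : 0 < l + 1 by llra.
      move: st; rewrite ltr_pdivlMr// => st.
      apply: le_lt_trans st; rewrite mulrC ler_wpM2l//; llra.
    - by rewrite /b mulr0 c0 kp.
    - by rewrite /b mulr1 cl.
  apply: curve_length_geodesic => s t s0 st t1.
  have s1 : s <= 1 by exact: le_trans st t1.
  have t0 : 0 <= t by exact: le_trans s0 st.
  have [lt0 ltl] := sl t t0 t1; have [ls0 lsl] := sl s s0 s1.
  rewrite /= /b !pk; try by apply: cU.
  rewrite cg; try by apply: ci.
  by rewrite -mulrBr normrM (ger0_norm l0) distrC ger0_norm ?subr_ge0.
exists rho; split => //.
- move=> x y xy; have [U [sh [sho disj pU]] HU] := Hrho (p x).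
  have : (p @^-1` U) x by apply: HU; rewrite mdistxx.
  rewrite pU => -[V sV Vx]; have [_ [_ [k kc [pV kV kp pk]]]] := sho V sV.
  exists (k y); first by apply: pk; exact: HU.
  exact: (lift x U V k).
- move=> x y xy; have [U [sh [sho disj pU]] HU] := Hrho (p x).
  have : (p @^-1` U) x by apply: HU; rewrite mdistxx.
  rewrite pU => -[V sV Vx]; have [_ [_ [k kc [pV kV kp pk]]]] := sho V sV.
  have : ((mdist x y)%:E < rho%:E)%E by rewrite lte_fin.
  rewrite pm => /ereal_inf_lt[_ [c [cc c0 c1] <-] lc].
  have cU t : 0 <= t <= 1 -> mdist (p x) (p (c t)) < rho.
    move=> t01; rewrite -lte_fin; apply: le_lt_trans lc.
    by rewrite -c0; exact: (curve_length_ge_at (p \o c) t01).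
  have Vy : V y.
    rewrite -c1; apply: (@path_in_sheet U sh V c) => //.
    - by move=> W /sho[].
    - exact/within_continuous_on.
    - by move=> t /cU/HU.
    - by rewrite c0.
  rewrite -{2}(kp y)//; apply/esym; apply: (lift x U V k) => //.
  by rewrite -c1; apply: cU; rewrite ler01 lexx.
Qed.

End InjectivityRadius.

(** * Lifting local geodesics *)

Section Lifts.
Context {R : realType} {X Xt : metricType R} (p : Xt -> X).
Context {rho : R} (injp : injectivity_radius p rho).

Let rho0 : 0 < rho. Proof. by case: injp. Qed.

(** Two paths whose projections stay closer than the injectivity radius remain
    close in the cover if they start so. *)
Lemma track_lifts (a b eps : R) (A B : R -> Xt) : a <= b -> eps < rho ->
  continuous_on a b A -> continuous_on a b B ->
  (forall t, a <= t <= b -> mdist (p (A t)) (p (B t)) <= eps) ->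
  mdist (A a) (B a) < rho ->
  mdist (A b) (B b) <= eps.
Proof.
move=> ab er cA cB pAB AB0; have [_ _ inj] := injp.
pose P t := mdist (A t) (B t) <= eps.
suff : P b by [].
apply: (@real_induction _ a b P) => //.
  by rewrite /P -inj//; apply: pAB; rewrite lexx.
move=> t tab; pose eta := (rho - eps) / 8.
have eta0 : 0 < eta by rewrite /eta; llra.
have [e1 e10 H1] := cA t tab eta eta0; have [e2 e20 H2] := cB t tab eta eta0.
exists (Num.min e1 e2); first by rewrite lt_min e10.
move=> s u /andP[as_ st] /andP[tu ub] tes ute; rewrite /P => Ps.
have near_t r : a <= r -> r <= b -> t - Num.min e1 e2 < r ->
    r < t + Num.min e1 e2 -> mdist (A r) (A t) < eta /\ mdist (B r) (B t) < eta.
  move=> ar rb r1 r2; have : `|r - t| < Num.min e1 e2.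
    by rewrite ltr_norml; apply/andP; split; llra.
  by rewrite lt_min => /andP[? ?]; split; [apply: H1|apply: H2] => //; apply/andP.
have [As Bs] := near_t s as_ (le_trans st (le_trans tu ub)) tes
  (le_lt_trans (le_trans st tu) ute).
have [Au Bu] := near_t u (le_trans as_ (le_trans st tu)) ub
  (lt_le_trans tes (le_trans st tu)) ute.
rewrite -inj; first by apply: pAB; apply/andP; split; llra.
have h1 := metric_triangle (A u) (A t) (B u).
have h2 := metric_triangle (A t) (A s) (B u).
have h3 := metric_triangle (A s) (B s) (B u).
have h4 := metric_triangle (B s) (B t) (B u).
rewrite (metric_sym (A t) (A s)) in h2; rewrite (metric_sym (B t) (B u)) in h4.
by move: h1 h2 h3 h4 As Bs Au Bu Ps; rewrite /eta; llra.
Qed.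

(** Every continuous lift of a local geodesic is 1-Lipschitz. *)
Lemma continuous_lift_lipschitz (g : R -> X) (gt : R -> Xt) s t :
  locally_isometric g -> is_lift p gt g -> mdist (gt s) (gt t) <= `|s - t|.
Proof.
move=> gi [gtc pg]; have [_ _ inj] := injp.
wlog st : s t / s <= t => [H|].
  by have [/H//|/ltW/H] := leP s t; rewrite metric_sym distrC.
rewrite distrC ger0_norm ?subr_ge0//.
apply: lipschitz_of_local => // u _.
have /nbhs_real[e e0 He] : nbhs u [set r | mdist (gt u) (gt r) < rho / 2].
  apply: (gtc u [set z | mdist (gt u) z < rho / 2]).
  by apply/nbhs_mdist; exists (rho / 2) => //; rewrite divr_gt0.
exists e => // x y ux xy yu _ _.
have -> : mdist (gt x) (gt y) = mdist (g x) (g y).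
  rewrite -!pg inj//; apply: le_lt_trans (metric_triangle _ (gt u) _) _.
  have : mdist (gt u) (gt x) < rho / 2.
    by apply: He; rewrite ltr_norml; apply/andP; split; llra.
  have : mdist (gt u) (gt y) < rho / 2.
    by apply: He; rewrite ltr_norml; apply/andP; split; llra.
  rewrite (metric_sym (gt u) (gt x)); llra.
apply: le_trans (locally_isometric_lipschitz _ _ gi) _.
by rewrite distrC ger0_norm ?subr_ge0.
Qed.

(* a point over [y] at the same distance from [x] as [y] from [p x], or the
   default value [x] when there is none *)
Let pick (x : Xt) (y : X) : Xt :=
  xget x [set z | p z = y /\ mdist x z = mdist (p x) y].

Let pickP x y : mdist (p x) y < rho ->
  p (pick x y) = y /\ mdist x (pick x y) = mdist (p x) y.
Proof.
move=> xy; have [_ /(_ x y xy)[z pz xz] _] := injp.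
by apply: (@xgetPex _ x [set z | p z = y /\ mdist x z = mdist (p x) y]); exists z.
Qed.

(* successive lifts over intervals of length [rho / 4], short enough for two
   consecutive choices in a fibre to be compatible *)
Let lift_upto (g : R -> X) (x : Xt) : nat -> R -> Xt := fix F n t :=
  if n is m.+1 then
    if t <= m%:R * (rho / 4) then F m t
    else pick (F m (m%:R * (rho / 4))) (g t)
  else x.

Let lift_half_line (g : R -> X) (x : Xt) :
  (forall s t : R, 0 <= s -> s <= t -> mdist (g s) (g t) <= t - s) -> p x = g 0 ->
  exists L : R -> Xt, [/\ L 0 = x, forall t : R, 0 <= t -> p (L t) = g t &
    forall s t : R, 0 <= s -> s <= t -> mdist (L s) (L t) <= t - s].
Proof.
move=> gl px; set F := lift_upto g x; pose r := rho / 4.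
have r0 : 0 < r by rewrite /r divr_gt0.
have [_ _ inj] := injp.
have nr n : 0 <= n%:R * r by rewrite mulr_ge0// ltW.
have FS n t : F n.+1 t = if t <= n%:R * r then F n t
    else pick (F n (n%:R * r)) (g t) by [].
have nrS n : n.+1%:R * r = n%:R * r + r by rewrite -natr1 mulrDl mul1r.
have inv n : [/\ F n 0 = x, forall t : R, 0 <= t -> t <= n%:R * r -> p (F n t) = g t &
    forall s t : R, 0 <= s -> s <= t -> t <= n%:R * r -> mdist (F n s) (F n t) <= t - s].
  elim: n => [|n [F0 pF lF]].
    split=> // [t t0|s t s0 st]; rewrite mul0r => t1.
      by have -> : t = 0 by apply/eqP; rewrite eq_le t0 t1.
    by rewrite mdistxx subr_ge0.
  have base : p (F n (n%:R * r)) = g (n%:R * r) by apply: pF.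
  have pk t : n%:R * r <= t -> t <= n.+1%:R * r ->
      p (pick (F n (n%:R * r)) (g t)) = g t /\
      mdist (F n (n%:R * r)) (pick (F n (n%:R * r)) (g t)) =
        mdist (g (n%:R * r)) (g t).
    move=> t1; rewrite nrS => t2; rewrite -base; apply: pickP.
    rewrite base; apply: le_lt_trans (gl _ _ (nr n) t1) _.
    by move: t2 rho0; rewrite /r; llra.
  split=> [|t t0 t1|s t s0 st t1].
  - by rewrite FS nr.
  - rewrite FS; case: leP => [tn|/ltW nt]; first exact: pF.
    by have [] := pk t nt t1.
  - have [tn|nt] := leP t (n%:R * r).
      by rewrite !FS tn (le_trans st tn); exact: lF.
    have [pt dt] := pk t (ltW nt) t1.
    have gnt := gl _ _ (nr n) (ltW nt).
    rewrite FS (FS n t) (leNgt t) nt/=.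
    have [sn|ns] := leP s (n%:R * r).
      apply: le_trans (metric_triangle _ (F n (n%:R * r)) _) _.
      by rewrite dt; have := lF _ _ s0 sn (lexx _); move: gnt; llra.
    have [ps ds] := pk s (ltW ns) (le_trans st t1).
    rewrite -inj; first by rewrite ps pt; exact: gl.
    apply: le_lt_trans (metric_triangle _ (F n (n%:R * r)) _) _.
    rewrite metric_sym ds dt; have := gl _ _ (nr n) (ltW ns).
    by move: gnt t1 st ns rho0; rewrite nrS /r; llra.
have coh n k t : t <= n%:R * r -> F (k + n)%N t = F n t.
  move=> tn; elim: k => // k IH; rewrite addSn FS IH ifT//.
  by apply: le_trans tn _; rewrite ler_pM2r// ler_nat leq_addl.
have coh2 n m t : t <= n%:R * r -> t <= m%:R * r -> F n t = F m t.
  move=> tn tm; have [nm|/ltnW mn] := leqP n m.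
    by rewrite -(subnK nm) coh.
  by rewrite -(subnK mn) coh.
(* the number of steps needed to reach [t] *)
pose N t := (Num.truncn (t / r)).+1.
have NP t : 0 <= t -> t <= (N t)%:R * r.
  move=> t0; rewrite -ler_pdivrMr//; apply: ltW.
  by have /andP[_] := truncn_itv (divr_ge0 t0 (ltW r0)).
exists (fun t => F (N t) t); split.
- by have [] := inv (N 0).
- by move=> t t0; have [_ pF _] := inv (N t); apply: pF => //; exact: NP.
- move=> s t s0 st; have t0 := le_trans s0 st.
  rewrite (coh2 (N s) (N t) s (NP s s0) (le_trans st (NP t t0))).
  by have [_ _ lF] := inv (N t); apply: lF => //; exact: NP.
Qed.

(** Unit-speed lifts exist through any point over [g t0]. *)
Lemma lipschitz_lift_exists (g : R -> X) (t0 : R) (x : Xt) :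
  locally_isometric g -> p x = g t0 ->
  exists gt : R -> Xt, [/\ gt t0 = x, forall t, p (gt t) = g t &
    forall s t, mdist (gt s) (gt t) <= `|s - t|].
Proof.
move=> gi px.
have gl s t : s <= t -> mdist (g s) (g t) <= t - s.
  move=> st; apply: le_trans (locally_isometric_lipschitz _ _ gi) _.
  by rewrite distrC ger0_norm ?subr_ge0.
have [||L1 [L10 pL1 lL1]] := @lift_half_line (fun t => g (t0 + t)) x.
- by move=> s t s0 st; apply: le_trans (gl _ _ _) _; llra.
- by rewrite addr0.
have [||L2 [L20 pL2 lL2]] := @lift_half_line (fun t => g (t0 - t)) x.
- by move=> s t s0 st; rewrite metric_sym; apply: le_trans (gl _ _ _) _; llra.
- by rewrite subr0.
exists (fun t => if t0 <= t then L1 (t - t0) else L2 (t0 - t)); split.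
- by rewrite lexx subrr.
- move=> t; case: leP => [t0t|tt0].
    by rewrite pL1 ?subr_ge0//; congr g; ring.
  by rewrite pL2 ?subr_ge0 ?ltW//; congr g; ring.
- move=> s t; wlog st : s t / s <= t => [H|].
    by have [/H//|/ltW/H] := leP s t; rewrite metric_sym distrC.
  rewrite distrC ger0_norm ?subr_ge0//.
  have [t0s|st0] := leP t0 s.
    rewrite (le_trans t0s st); apply: le_trans (lL1 _ _ _ _) _; llra.
  have [t0t|tt0] := leP t0 t.
    apply: le_trans (metric_triangle _ x _) _.
    have h1 := lL1 0 (t - t0) (lexx _) ltac:(llra).
    have h2 := lL2 0 (t0 - s) (lexx _) ltac:(llra).
    by rewrite metric_sym; move: h1 h2; rewrite L10 L20; llra.
  by rewrite metric_sym; apply: le_trans (lL2 _ _ _ _) _; llra.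
Qed.

Lemma lift_locally_isometric (g : R -> X) (gt : R -> Xt) :
  locally_isometric g -> (forall t, p (gt t) = g t) ->
  (forall s t, mdist (gt s) (gt t) <= `|s - t|) -> locally_isometric gt.
Proof.
move=> gi pg gl t; have [_ _ inj] := injp; have [e e0 He] := gi t.
exists (Num.min e (rho / 2)); first by rewrite lt_min e0 divr_gt0.
move=> s u; rewrite !lt_min => /andP[se sr] /andP[ue ur].
rewrite -He// -!pg inj//; apply: le_lt_trans (gl s u) _.
have -> : s - u = (s - t) - (u - t) by ring.
by apply: le_lt_trans (ler_normB _ _) _; llra.
Qed.

Lemma projection_locally_isometric (gt : R -> Xt) :
  geodesic_line gt -> locally_isometric (p \o gt).
Proof.
move=> gl t; have [_ _ inj] := injp; exists (rho / 2); first exact: divr_gt0.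
move=> s u sr ur; rewrite /= inj ?gl//.
have -> : s - u = (s - t) - (u - t) by ring.
by apply: le_lt_trans (ler_normB _ _) _; llra.
Qed.

Lemma lipschitz_continuous_on (T : metricType R) (a b : R) (c : R -> T) :
  (forall s t, mdist (c s) (c t) <= `|s - t|) -> continuous_on a b c.
Proof.
move=> cl t _ eps eps0; exists eps => // s _ st.
exact: le_lt_trans (cl s t) st.
Qed.

Lemma lipschitz_continuous (T : metricType R) (c : R -> T) :
  (forall s t, mdist (c s) (c t) <= `|s - t|) -> continuous c.
Proof.
move=> cl t A /nbhs_mdist[e e0 He]; apply/nbhs_real; exists e => // s st.
by apply: He; rewrite metric_sym; exact: le_lt_trans (cl s t) st.
Qed.

End Lifts.

(** * Local geodesics near a fat line *)

Section FatLine.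
Context {R : realType} {Xt : metricType R}.

(** [N_w(g)] is isometric to a product with the line [g] as one of its lines. *)
Definition fat_line (w : R) (g : R -> Xt) : Prop :=
  exists (Y : metricType R) (f : R * Y -> Xt) (y0 : Y),
    [/\ range f = line_nbhd w g,
        forall a b, mdist (f a) (f b) =
          Num.sqrt ((a.1 - b.1) ^+ 2 + mdist a.2 b.2 ^+ 2) &
        forall t, g t = f (t, y0)].

Lemma line_nbhd_reverse w (g : R -> Xt) :
  line_nbhd w (fun s => g (- s)) = line_nbhd w g.
Proof.
apply/seteqP; split=> x [t xt]; exists (- t) => //.
by rewrite opprK.
Qed.

Lemma fat_line_reverse w (g : R -> Xt) :
  fat_line w g -> fat_line w (fun s => g (- s)).
Proof.
move=> [Y [f [y0 [rf df gf]]]].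
exists Y, (fun a => f (- a.1, a.2)), y0; split=> [|a b|t].
- rewrite line_nbhd_reverse -rf; apply/seteqP; split=> x [a _ <-].
    by exists (- a.1, a.2).
  by exists (- a.1, a.2) => //=; rewrite opprK; case: a.
- rewrite df/=; congr (Num.sqrt (_ + _)); ring.
- by rewrite gf.
Qed.

Lemma geodesic_line_reverse (g : R -> Xt) :
  geodesic_line g -> geodesic_line (fun s => g (- s)).
Proof.
move=> gl s t; rewrite gl -normrN; congr (`|_|); ring.
Qed.

(** In the product structure around a fat line, a local geodesic [eta] has a
    position [P t] along the line and a height [h t] above it. While [eta]
    stays in the neighborhood, the position moves at constant speed [v] and
    the height is Lipschitz with constant [sqrt (1 - v ^ 2)]. *)
Lemma fat_line_coordinates (w : R) (g eta : R -> Xt) :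
  fat_line w g -> locally_isometric eta ->
  exists P h : R -> R,
    (forall t, line_nbhd w g (eta t) -> 0 <= h t /\
       forall s, mdist (eta t) (g s) ^+ 2 = (P t - s) ^+ 2 + h t ^+ 2) /\
    (forall a b, a < b -> (forall t, a <= t -> t <= b -> line_nbhd w g (eta t)) ->
       exists2 v : R, v ^+ 2 <= 1 &
         forall s u, a <= s -> s <= u -> u <= b ->
           P u - P s = v * (u - s) /\
           `|h u - h s| <= Num.sqrt (1 - v ^+ 2) * (u - s)).
Proof.
move=> [Y [f [y0 [rf df gf]]]] ei.
have /choice[q Hq] : forall t, exists a, line_nbhd w g (eta t) -> f a = eta t.
  move=> t.
  have [Nt|Nt] := pselect (line_nbhd w g (eta t)); last by exists (0, y0).
  by move: (Nt); rewrite -rf => -[a _ fa]; exists a.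
have df2 a b : mdist (f a) (f b) ^+ 2 = (a.1 - b.1) ^+ 2 + mdist a.2 b.2 ^+ 2.
  by rewrite df sqr_sqrtr// addr_ge0// sqr_ge0.
exists (fun t => (q t).1), (fun t => mdist (q t).2 y0); split.
  by move=> t Nt; split=> [|s]; rewrite ?mdist_ge0// -(Hq t Nt) gf df2.
move=> a b ab N.
have [|v v1 Hv] := @product_geodesic_affine R Y a b q ab.
  move=> t /andP[at_ tb]; have [e e0 He] := ei t; exists e => // s u.
  move=> /andP[as_ sb] /andP[au ub] st ut.
  by rewrite -df2 (Hq s (N s as_ sb)) (Hq u (N u au ub)) He// real_normK ?num_real.
exists v => // s u as_ su ub; have [-> dv] := Hv s u as_ su ub; split=> //.
apply: le_trans dv; rewrite ler_norml; apply/andP; split.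
  by have := metric_triangle (q s).2 (q u).2 y0; llra.
have := metric_triangle (q u).2 (q s).2 y0.
by rewrite (metric_sym (q u).2 (q s).2); llra.
Qed.

Lemma sqr_le_components (a h d : R) : 0 <= d -> 0 <= h ->
  d ^+ 2 = a ^+ 2 + h ^+ 2 -> `|a| <= d /\ h <= d.
Proof.
move=> d0 h0 e; split.
  rewrite -(@ler_pXn2r _ 2)// ?nnegrE// real_normK ?num_real// e lerDl sqr_ge0//.
by rewrite -(@ler_pXn2r _ 2)// ?nnegrE// e lerDr sqr_ge0.
Qed.
End FatLine.

Section Shadowing.
Context {R : realType} {Xt : metricType R}.

(** A local geodesic shadowing a fat line for a long time [T] leaves it with
    slope at most of order [(eps / T)^(1/2)], hence keeps shadowing it for a
    further time [L], small with respect to [T]. *)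
Lemma fat_line_shadowing_extends (w eps T L : R) (g y : R -> Xt) :
  fat_line w g -> locally_isometric y ->
  0 < eps -> 5 * eps < w -> 0 < L -> 4 * L <= T -> 16 * L ^+ 2 <= T * eps ->
  (forall s, 0 <= s -> s <= T -> mdist (y s) (g s) <= eps) ->
  (forall s t, mdist (g s) (g t) <= `|s - t|) ->
  forall s, 0 <= s -> s <= T + L -> mdist (y s) (g s) <= 3 * eps.
Proof.
move=> fw yi eps0 epsw L0 LT LT2 near0 gl.
have T0 : 0 < T by llra.
have yl := locally_isometric_lipschitz _ _ yi.
have [P [h [Ph aff]]] := fat_line_coordinates fw yi.
have near s : line_nbhd w g (y s) -> forall e, 0 <= e -> mdist (y s) (g s) <= e ->
    [/\ P s - s <= e, - e <= P s - s & h s <= e].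
  move=> Ns e e0 ye; have [h0 /(_ s) d2] := Ph s Ns.
  have [a1 a2] := sqr_le_components (mdist_ge0 _ _) h0 d2.
  have := le_trans a1 ye; rewrite ler_norml => /andP[b1 b2].
  by split=> //; exact: le_trans a2 ye.
(* the estimate, as long as [y] stays in the neighborhood; the part of the
   trajectory in [0, T] gives [v = 1] up to [2 * eps / T] *)
have bound u : T <= u -> u <= T + L ->
    (forall s, 0 <= s -> s <= u -> line_nbhd w g (y s)) ->
    forall s, 0 <= s -> s <= u -> mdist (y s) (g s) <= 3 * eps.
  move=> Tu uTL Nu s s0 su.
  have [sT|Ts] := leP s T.
    by apply: le_trans (near0 s s0 sT) _; llra.
  have u0 : 0 < u by llra.
  have [v v1 Hv] := aff 0 u u0 Nu.
  have [p1 p2 _] := near 0 (Nu 0 (lexx _) (ltW u0)) eps (ltW eps0)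
    (near0 0 (lexx _) (ltW T0)).
  have [q1 q2 q3] := near T (Nu T (ltW T0) Tu) eps (ltW eps0)
    (near0 T (ltW T0) (lexx _)).
  have [r1 _] := Hv 0 T (lexx _) (ltW T0) Tu.
  have [s1 s2] := Hv T s (ltW T0) (ltW Ts) su.
  have [hs0 /(_ s) ds] := Ph s (Nu s s0 su).
  have [hT0 _] := Ph T (Nu T (ltW T0) Tu).
  clear Nu Hv aff Ph near near0 yl yi gl fw.
  have v1' : v <= 1.
    by rewrite leNgt; apply/negP => v2; have : 1 < v ^+ 2; [rewrite expr_gt1// ltW//; llra|llra].
  have vT : (1 - v) * T <= 2 * eps by llra.
  have sTL : s - T <= L by llra.
  have vL : (1 - v) * (s - T) <= eps / 2.
    apply: (@le_trans _ _ ((1 - v) * (T / 4))); last by llra.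
    by apply: ler_wpM2l; llra.
  have vL0 : 0 <= (1 - v) * (s - T) by apply: mulr_ge0; llra.
  have B1 : `|P s - s| <= eps * (3 / 2).
    by rewrite ler_norml; apply/andP; split; llra.
  have B2 : Num.sqrt (1 - v ^+ 2) * (s - T) <= eps / 2.
    apply: (@le_trans _ _ (Num.sqrt (1 - v ^+ 2) * L)).
      by apply: ler_wpM2l sTL; exact: sqrtr_ge0.
    have e2 : 0 <= eps / 2 by llra.
    rewrite -(@ler_pXn2r _ 2)// ?nnegrE//; last first.
      by apply: mulr_ge0; [exact: sqrtr_ge0|llra].
    rewrite exprMn sqr_sqrtr ?subr_ge0//.
    rewrite -(ler_pM2r T0).
    have k1 : (1 - v ^+ 2) * T <= 4 * eps.
      have -> : (1 - v ^+ 2) * T = (1 + v) * ((1 - v) * T) by ring.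
      apply: (@le_trans _ _ (2 * ((1 - v) * T))); last by llra.
      by apply: ler_wpM2r; [apply: mulr_ge0; llra|llra].
    have -> : (1 - v ^+ 2) * L ^+ 2 * T = ((1 - v ^+ 2) * T) * L ^+ 2 by ring.
    apply: (@le_trans _ _ (4 * eps * L ^+ 2)).
      by apply: ler_wpM2r k1; exact: sqr_ge0.
    have -> : (eps / 2) ^+ 2 * T = eps / 4 * (T * eps) by field.
    have -> : 4 * eps * L ^+ 2 = eps / 4 * (16 * L ^+ 2) by field.
    by apply: ler_wpM2l LT2; llra.
  have B3 : h s <= eps * (3 / 2).
    by move: s2; rewrite ler_norml => /andP[_ s2]; llra.
  have e32 : 0 <= eps * (3 / 2) by llra.
  rewrite -(@ler_pXn2r _ 2)// ?nnegrE ?mdist_ge0//; last by llra.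
  rewrite ds.
  have C1 : (P s - s) ^+ 2 <= (eps * (3 / 2)) ^+ 2.
    by rewrite -real_normK ?num_real// ler_pXn2r// nnegrE.
  have C2 : h s ^+ 2 <= (eps * (3 / 2)) ^+ 2 by rewrite ler_pXn2r// nnegrE.
  have E1 : (eps * (3 / 2)) ^+ 2 = eps ^+ 2 * (9 / 4) by field.
  have E2 : (3 * eps) ^+ 2 = 9 * eps ^+ 2 by ring.
  rewrite E2; rewrite E1 in C1 C2; apply: le_trans (lerD C1 C2) _.
  by have := sqr_ge0 eps; clear; llra.
(* [y] cannot leave the neighborhood, as [3 * eps < w] *)
have N : forall s, 0 <= s -> s <= T + L -> line_nbhd w g (y s).
  pose Q u := forall s, 0 <= s -> s <= u -> line_nbhd w g (y s).
  suff : Q (T + L) by [].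
  apply: (@real_induction _ T (T + L) Q); first by llra.
    by move=> s s0 sT; exists s; apply: le_lt_trans (near0 s s0 sT) _; llra.
  move=> t /andP[Tt tTL]; exists (eps / 2); first by llra.
  move=> s u /andP[Ts st] /andP[tu uTL] tes ute Qs r r0 ru.
  have [rs|sr] := leP r s; first exact: Qs.
  have sb := bound s Ts (le_trans st tTL) Qs s (le_trans (ltW T0) Ts) (lexx _).
  exists s; apply: le_lt_trans (metric_triangle _ (y s) _) _.
  have := yl r s; rewrite ger0_norm ?subr_ge0 ?(ltW sr)//.
  by move: sb; llra.
move=> s s0 sTL; apply: (bound (T + L)) => //; llra.
Qed.
End Shadowing.

Section Asymptotic.
Context {R : realType} {X Xt : metricType R} (p : Xt -> X).
Context {rho : R} (injp : injectivity_radius p rho).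

Lemma lipschitz_comp_continuous_on (T : metricType R) (a b : R) (c : R -> T)
    (k : R -> R) :
  (forall s t, mdist (c s) (c t) <= `|s - t|) ->
  {within `[a, b]%classic, continuous k} -> continuous_on a b (c \o k).
Proof.
move=> cl /subspace_continuousP kc t tab eps eps0.
have tab' : `[a, b]%classic t by exact/set_itvccP.
have : nbhs (k t) [set r : R | `|r - k t| < eps] by apply/nbhs_real; exists eps.
move=> /(kc t tab'); rewrite /nbhs/= /within/= => /nbhs_real[e e0 He].
exists e => // s sab st; apply: le_lt_trans (cl _ _) _.
by apply: He => //; exact/set_itvccP.
Qed.

Lemma continuous_on_sub (T : metricType R) (a b a' b' : R) (c : R -> T) :
  a <= a' -> b' <= b -> continuous_on a b c -> continuous_on a' b' c.
Proof.
move=> aa bb cc t /andP[a't tb'] eps eps0.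
have [|e e0 He] := cc t _ eps eps0.
  by rewrite (le_trans aa a't) (le_trans tb' bb).
exists e => // s /andP[a's sb'] st; apply: He => //.
by rewrite (le_trans aa a's) (le_trans sb' bb).
Qed.

(** A local geodesic asymptotic to a fat line, up to time changes [beta] and
    [kappa] given on consecutive unit intervals, is a translate of it. *)
Lemma asymptotic_to_fat_line (w c0 : R) (g : R -> Xt) (y : R -> X)
    (beta kappa : nat -> R -> R) :
  0 < w -> geodesic_line g -> fat_line w g -> locally_isometric y ->
  (forall n, {within `[0, 1]%classic, continuous (beta n)}) ->
  (forall n, {within `[0, 1]%classic, continuous (kappa n)}) ->
  (forall n, beta n 1 = beta n.+1 0) -> (forall n, kappa n 1 = kappa n.+1 0) ->
  0 < c0 -> (forall n, beta n 0 + c0 <= beta n 1) ->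
  (forall u eps, 0 < eps -> exists N, forall n s, (N <= n)%N -> 0 <= s <= 1 ->
     mdist (y (beta n s + u)) (p (g (kappa n s + u))) <= eps) ->
  exists c, forall t, y t = p (g (t + c)).
Proof.
move=> w0 gl fw yi bc kc b1 k1 c00 bgrow asym.
have [rho0 lftp inj] := injp.
have gl1 s t : mdist (g s) (g t) <= `|s - t| by rewrite gl.
pose e0 := Num.min rho w / 4.
have m0 : 0 < Num.min rho w by rewrite lt_min rho0.
have e00 : 0 < e0 by rewrite /e0; llra.
have e0r : e0 <= rho / 4.
  by rewrite /e0 ler_pM2r ?invr_gt0//; rewrite ge_min lexx.
have e0w : e0 < w.
  by have : Num.min rho w <= w by [rewrite ge_min lexx orbT]; rewrite /e0; llra.
have [N0 HN0] := asym 0 e0 e00.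
have asym0 n s : (N0 <= n)%N -> 0 <= s <= 1 ->
    mdist (y (beta n s)) (p (g (kappa n s))) <= e0.
  by move=> /HN0 /[apply]; rewrite !addr0.
have s01 : 0 <= (0 : R) <= 1. by apply/andP; split.
have [|x px gx] := lftp (g (kappa N0 0)) (y (beta N0 0)).
  rewrite metric_sym; apply: le_lt_trans (asym0 _ _ (leqnn _) s01) _; llra.
have [yt [ytx pyt ytl]] := lipschitz_lift_exists injp yi px.
have yti := lift_locally_isometric injp yi pyt ytl.
have trackn n s : (N0 <= n)%N -> 0 <= s <= 1 ->
    mdist (yt (beta n 0)) (g (kappa n 0)) <= e0 ->
    mdist (yt (beta n s)) (g (kappa n s)) <= e0.
  move=> Nn /andP[s0 s1] h0.
  apply: (@track_lifts _ _ _ p rho injp 0 s e0 (yt \o beta n) (g \o kappa n)) => //.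
  - by llra.
  - exact: continuous_on_sub (lexx _) s1 (lipschitz_comp_continuous_on ytl (bc n)).
  - exact: continuous_on_sub (lexx _) s1 (lipschitz_comp_continuous_on gl1 (kc n)).
  - move=> t /andP[t0 ts]; rewrite /= pyt; apply: asym0 => //.
    by rewrite t0 (le_trans ts s1).
  - by apply: le_lt_trans h0 _; llra.
(* the lift follows the line over the successive pieces *)
have start n : mdist (yt (beta (N0 + n)%N 0)) (g (kappa (N0 + n)%N 0)) <= e0.
  elim: n => [|n IH].
    rewrite addn0 ytx metric_sym gx metric_sym; exact: asym0.
  rewrite addnS -b1 -k1; apply: trackn => //; first exact: leq_addr.
  by apply/andP; split.
have close n s : (N0 <= n)%N -> 0 <= s <= 1 ->
    mdist (yt (beta n s)) (g (kappa n s)) <= e0.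
  move=> Nn s1; apply: trackn => //.
  by have := start (n - N0)%N; rewrite subnKC.
(* comparing positions at times differing by [u0], small enough for the
   estimates of [X] to hold in the cover, will determine the slope *)
pose u0 := rho / 8.
have u00 : 0 < u0 by rewrite /u0; llra.
have asymt u eps : 0 <= u -> u <= u0 -> 0 < eps ->
    exists2 N, (N0 <= N)%N & forall n s, (N <= n)%N -> 0 <= s <= 1 ->
      mdist (yt (beta n s + u)) (g (kappa n s + u)) <= eps.
  move=> up uu eps0; have [N HN] := asym u eps eps0.
  exists (maxn N N0); first exact: leq_maxr.
  move=> n s; rewrite geq_max => /andP[Nn N0n] s1.
  rewrite -inj; first by rewrite pyt; exact: HN.
  have h1 := metric_triangle (yt (beta n s + u)) (yt (beta n s)) (g (kappa n s + u)).
  have h2 := metric_triangle (yt (beta n s)) (g (kappa n s)) (g (kappa n s + u)).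
  have h3 := ytl (beta n s + u) (beta n s).
  have h4 := gl (kappa n s) (kappa n s + u).
  have h5 := close n s N0n s1.
  move: h3 h4; rewrite opprD addNKr normrN addrAC subrr add0r ger0_norm// => h3 h4.
  by move: h1 h2 h3 h4 h5 e0r uu rho0; rewrite /u0; clear; llra.
pose T0 := beta N0 0.
have grow n : T0 + n%:R * c0 <= beta (N0 + n)%N 0.
  elim: n => [|n IH]; first by rewrite mul0r addr0 addn0.
  by rewrite addnS -b1; apply: le_trans (bgrow _); rewrite -natr1 mulrDl; llra.
have cover n : forall t, T0 <= t -> t <= beta (N0 + n)%N 0 ->
    line_nbhd w g (yt t).
  elim: n => [|n IH] t tT.
    rewrite addn0 => tle; have -> : t = T0 by apply/eqP; rewrite eq_le tT tle.
    by exists (kappa N0 0); apply: le_lt_trans (close _ _ (leqnn _) s01) _.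
  rewrite addnS -b1 => tb; have [tn|/ltW nt] := leP t (beta (N0 + n)%N 0).
    exact: IH.
  have [|s] := @IVT _ (beta (N0 + n)%N) 0 1 t ler01 (bc _).
    by rewrite ge_min nt le_max tb orbT.
  rewrite in_itv/= => s1 <-; exists (kappa (N0 + n)%N s).
  by apply: le_lt_trans (close _ _ (leq_addr _ _) s1) _.
have far b : exists n, b <= beta (N0 + n)%N 0.
  exists (Num.truncn (`|b - T0| / c0)).+1; apply: le_trans (grow _).
  have /andP[_ /ltW] := truncn_itv (divr_ge0 (normr_ge0 (b - T0)) (ltW c00)).
  by rewrite ler_pdivrMr// => h; have := ler_norm (b - T0); llra.
have Nt t : T0 <= t -> line_nbhd w g (yt t).
  by move=> Tt; have [n tn] := far t; exact: (cover n).
have [P [h [Ph aff]]] := fat_line_coordinates fw yti.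
have near t r e : line_nbhd w g (yt t) -> mdist (yt t) (g r) <= e ->
    [/\ P t - r <= e, - e <= P t - r, 0 <= h t & h t <= e].
  move=> Ns ye; have [h0 /(_ r) d2] := Ph t Ns.
  have [a1 a2] := sqr_le_components (mdist_ge0 _ _) h0 d2.
  have := le_trans a1 ye; rewrite ler_norml => /andP[b1' b2].
  by split=> //; exact: le_trans a2 ye.
have late b eps : T0 <= b -> 0 < eps -> exists2 t, b <= t &
    `|P (t + u0) - P t - u0| <= eps /\ h t <= eps.
  move=> Tb eps0; have e20 : 0 < eps / 2 by llra.
  have [N1 NN1 H1] := asymt 0 _ (lexx _) (ltW u00) e20.
  have [N2 NN2 H2] := asymt u0 _ (ltW u00) (lexx _) e20.
  have [n bn] := far b; pose m := (N0 + (n + (N1 + N2)))%N.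
  have bm : b <= beta m 0.
    apply: le_trans bn _; rewrite /m addnA.
    elim: (N1 + N2)%N => [|k IH]; first by rewrite addn0.
    by apply: le_trans IH _; rewrite addnS -b1; have := bgrow (N0 + n + k)%N; llra.
  have Tm : T0 <= beta m 0 by exact: le_trans Tb bm.
  exists (beta m 0) => //.
  have [||q1 q2 q3 q4] := near (beta m 0) (kappa m 0) (eps / 2); first exact: Nt.
    have := H1 m 0 _ s01; rewrite !addr0; apply.
    exact: leq_trans (leq_addr N2 N1) (leq_trans (leq_addl n _) (leq_addl N0 _)).
  have [||r1 r2 r3 r4] := near (beta m 0 + u0) (kappa m 0 + u0) (eps / 2).
  - by apply: Nt; llra.
  - apply: H2 => //.
    exact: leq_trans (leq_addl N1 N2) (leq_trans (leq_addl n _) (leq_addl N0 _)).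
  by split; [rewrite ler_norml; apply/andP; split|]; llra.
(* the slope is 1, hence the height is constant, hence zero *)
have slope a b v : a <= T0 -> T0 < b ->
    (forall t, a <= t -> t <= b -> line_nbhd w g (yt t)) ->
    (forall s u, a <= s -> s <= u -> u <= b -> P u - P s = v * (u - s)) -> v = 1.
  move=> aT Tb Nab Pv; apply/eqP; rewrite -subr_eq0 -normr_le0.
  apply/ler_addgt0Pl => eps eps0; rewrite addr0.
  have [t bt [Pt _]] := late b (eps * u0) (ltW Tb) (mulr_gt0 eps0 u00).
  have [||v' _ Hv'] := aff T0 (t + u0); first by llra.
    by move=> r Tr _; exact: Nt.
  have btu : b <= t + u0 by llra.
  have [e1 _] := Hv' T0 b (lexx _) (ltW Tb) btu.
  have e2 := Pv T0 b aT (ltW Tb) (lexx _).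
  have bT : b - T0 != 0 by rewrite subr_eq0 gt_eqF.
  have vv : v = v' by apply: (mulIf bT); rewrite -e2.
  have [|||e3 _] := Hv' t (t + u0).
  - by llra.
  - by llra.
  - exact: lexx.
  rewrite -vv in e3; move: Pt; rewrite e3.
  have -> : v * (t + u0 - t) - u0 = (v - 1) * u0 by ring.
  by rewrite normrM (gtr0_norm u00) ler_pM2r.
have sqrt0 (v : R) : v = 1 -> Num.sqrt (1 - v ^+ 2) = 0.
  by move=> ->; rewrite expr1n subrr sqrtr0.
have hT t : T0 <= t -> h t = 0.
  move=> Tt; have [h0 _] := Ph t (Nt t Tt); apply/eqP; rewrite eq_le h0 andbT.
  apply/ler_addgt0Pl => eps eps0; rewrite addr0.
  have Tt1 : T0 <= t + 1 by llra.
  have [r tr [_ hr]] := late (t + 1) eps Tt1 eps0.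
  have Tr : T0 < r by llra.
  have [|v _ Hv] := aff T0 r Tr; first by move=> z Tz _; exact: Nt.
  have v1 : v = 1.
    apply: (slope T0 r v) => //; first by move=> z Tz _; exact: Nt.
    by move=> a b Ta ab br; have [] := Hv a b Ta ab br.
  have [||_] := Hv t r Tt; [by llra|by []|].
  by rewrite (sqrt0 v v1) mul0r normr_le0 subr_eq0 => /eqP <-.
pose c := P T0 - T0.
have onN b : (forall t, T0 - b <= t -> t <= T0 -> line_nbhd w g (yt t)) ->
    0 <= b -> forall t, T0 - b <= t -> t <= T0 + 1 + b -> yt t = g (t + c).
  move=> Nb b0 t bt tT; have bT : T0 - b < T0 + 1 + b by llra.
  have {}Nb x' : T0 - b <= x' -> x' <= T0 + 1 + b -> line_nbhd w g (yt x').
    move=> x1 _; have [x2|/ltW x2] := leP x' T0; [exact: Nb|exact: Nt].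
  have [v _ Hv] := aff _ _ bT Nb.
  have v1 : v = 1.
    apply: (slope (T0 - b) (T0 + 1 + b) v) => //; [by llra|by llra|].
    by move=> z x' zb zx xT; have [] := Hv z x' zb zx xT.
  have Pt : P t = t + c.
    have [tT0|/ltW T0t] := leP t T0.
      have [|+ _] := Hv t T0 bt tT0; first by llra.
      by rewrite v1 mul1r /c; llra.
    have [|+ _] := Hv T0 t _ T0t tT; first by llra.
    by rewrite v1 mul1r /c; llra.
  have ht : h t = 0.
    have [|_] := Hv t (T0 + 1 + b) bt tT; first exact: lexx.
    rewrite (sqrt0 v v1) mul0r normr_le0 subr_eq0 => /eqP <-.
    by apply: hT; llra.
  have [_ /(_ (t + c))] := Ph t (Nb t bt tT).
  rewrite Pt ht subrr expr0n/= addr0 => /eqP; rewrite sqrf_eq0 => /eqP.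
  exact: mdist_positivity.
(* the identity extends to the past, since the neighborhood contains all points at
   distance less than [w] from the line *)
have backward u : 0 <= u -> forall s, 0 <= s -> s <= u ->
    yt (T0 - s) = g (T0 - s + c).
  move=> up; pose Q u := forall s, 0 <= s -> s <= u -> yt (T0 - s) = g (T0 - s + c).
  suff : Q u by [].
  apply: (@real_induction _ 0 u Q) => //.
    move=> s s0 s0'; have -> : s = 0 by apply/eqP; rewrite eq_le s0 s0'.
    by apply: (onN 0); [move=> t t1 t2; apply: Nt; llra|llra|llra|llra].
  move=> t _; exists (w / 2); first by llra.
  move=> s z /andP[s0 st] /andP[tz zu] tes zte Qs r r0 rz.
  apply: (onN z); [|llra|llra|llra].
  move=> x' zx xT; have [rs|sr] := leP (T0 - x') s.
    have E : T0 - (T0 - x') = x' by ring.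
    have := Qs (T0 - x') _ rs; rewrite E => ->; last by llra.
    by exists (x' + c); rewrite mdistxx.
  exists (T0 - s + c); rewrite -Qs//.
  apply: le_lt_trans (ytl _ _) _; rewrite ltr_norml; apply/andP; split; llra.
have Nall t : t <= T0 -> line_nbhd w g (yt t).
  move=> tT; have t0 : 0 <= T0 - t by llra.
  have E : T0 - (T0 - t) = t by ring.
  have := backward (T0 - t) t0 (T0 - t) t0 (lexx _).
  rewrite E => ->; exists (t + c); by rewrite mdistxx.
exists c => t; rewrite -pyt; congr p.
have := ler_norm (t - T0); have := ler_norm (- (t - T0)); rewrite normrN => n1 n2.
by apply: (onN `|t - T0|); [move=> r _; exact: Nall|exact: normr_ge0|llra|llra].
Qed.
End Asymptotic.

(** * The metric of the space of geodesics *)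

Section GeodesicFlowMetric.
Context {R : realType} {X Xt : metricType R} (p : Xt -> X).
Context {rho : R} (injp : injectivity_radius p rho).
Local Notation mu := (@lebesgue_measure R).

Lemma integral_expR_abs_fin (C : R) : 0 <= C ->
  (\int[mu]_(t in [set: R]) (C * expR (- `|t|))%:E < +oo)%E.
Proof.
move=> C0; rewrite ge0_symfun_integralT; first last.
- by move=> t /=; rewrite normrN.
- move=> t; apply: cvgM; first exact: cvg_cst.
  apply: continuous_cvg; first exact: continuous_expR.
  by apply: cvgN; apply: norm_continuous.
- by move=> t; rewrite mulr_ge0// expR_ge0.
have -> : (\int[mu]_(x in [set x : R | (0 <= x)%R]) (C * expR (- `|x|))%:E =
    \int[mu]_(x in [set x : R | (0 <= x)%R]) (C%:E * (exponential_pdf 1 x)%:E))%E.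
  apply: eq_integral => t; rewrite inE/= => t0.
  by rewrite exponential_pdfE// mul1r mulN1r ger0_norm// EFinM.
have mpos : measurable [set x : R | 0 <= x] by rewrite -set_itvcy.
have mpdf : measurable_fun [set: R] (fun t : R => (exponential_pdf (1 : R) t)%:E).
  by apply/measurable_EFinP; exact: measurable_exponential_pdf.
have pdf0 t : (0 <= (exponential_pdf (1 : R) t)%:E)%E.
  by rewrite lee_fin exponential_pdf_ge0.
have : (\int[mu]_(x in [set x : R | (0 <= x)%R]) (C%:E * (exponential_pdf 1 x)%:E)
    <= C%:E)%E.
  apply: (@le_trans _ _ (\int[mu]_(x in [set: R]) (C%:E * (exponential_pdf 1 x)%:E))%E).
    apply: ge0_subset_integral => //.
      by apply: measurable_funeM; exact: mpdf.
    by move=> t _; rewrite mule_ge0// lee_fin.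
  by rewrite ge0_integralZl_EFin// integral_exponential_pdf// mule1.
move=> h; apply: le_lt_trans (lee_wpmul2l _ h) _ => //.
by rewrite -EFinM ltry.
Qed.

(** The integrand in the definition of [dGX]. *)
Definition weighted_dist (h1 h2 : R -> Xt) (t : R) : R :=
  mdist (h1 t) (h2 t) * expR (- (2 * `|t|)).

Lemma dist_lipschitz (h1 h2 : R -> Xt) :
  (forall s t, mdist (h1 s) (h1 t) <= `|s - t|) ->
  (forall s t, mdist (h2 s) (h2 t) <= `|s - t|) ->
  forall s t, mdist (h1 s) (h2 s) <= mdist (h1 t) (h2 t) + 2 * `|s - t|.
Proof.
move=> l1 l2 s t.
have a1 := metric_triangle (h1 s) (h1 t) (h2 s).
have a2 := metric_triangle (h1 t) (h2 t) (h2 s).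
by have := l1 s t; have := l2 t s; rewrite (distrC t s); move: a1 a2; llra.
Qed.

Lemma weighted_dist_measurable (h1 h2 : R -> Xt) :
  (forall s t, mdist (h1 s) (h1 t) <= `|s - t|) ->
  (forall s t, mdist (h2 s) (h2 t) <= `|s - t|) ->
  measurable_fun [set: R] (fun t => (weighted_dist h1 h2 t)%:E).
Proof.
move=> l1 l2; apply/measurable_EFinP; apply: continuous_measurable_fun => t.
apply: cvgM.
  apply/cvgrPdist_lt => e e0; apply/nbhs_real; exists (e / 2); first by llra.
  move=> s st; have d1 := dist_lipschitz l1 l2 s t.
  have := dist_lipschitz l1 l2 t s; rewrite (distrC t s) => d2.
  by rewrite ltr_norml; apply/andP; split; move: d1 d2 st; llra.
apply: continuous_cvg; first exact: continuous_expR.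
apply: cvgN; apply: cvgM; first exact: cvg_cst.
exact: norm_continuous.
Qed.

Lemma weighted_dist_ge0 (h1 h2 : R -> Xt) t : (0 <= (weighted_dist h1 h2 t)%:E)%E.
Proof. by rewrite lee_fin mulr_ge0 ?mdist_ge0// expR_ge0. Qed.

Lemma integral_weighted_dist_fin (h1 h2 : R -> Xt) :
  (forall s t, mdist (h1 s) (h1 t) <= `|s - t|) ->
  (forall s t, mdist (h2 s) (h2 t) <= `|s - t|) ->
  (\int[mu]_(t in [set: R]) (weighted_dist h1 h2 t)%:E < +oo)%E.
Proof.
move=> l1 l2; pose C := mdist (h1 0) (h2 0) + 2.
have C0 : 0 <= C by rewrite addr_ge0 ?mdist_ge0.
apply: le_lt_trans (integral_expR_abs_fin C0).
apply: ge0_le_integral => //.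
- by move=> t _; exact: weighted_dist_ge0.
- exact: weighted_dist_measurable.
- apply/measurable_EFinP; apply: continuous_measurable_fun => t.
  apply: cvgM; first exact: cvg_cst.
  apply: continuous_cvg; first exact: continuous_expR.
  by apply: cvgN; exact: norm_continuous.
move=> t _; rewrite lee_fin /weighted_dist.
have -> : - (2 * `|t|) = - `|t| + - `|t| by ring.
rewrite expRD mulrA ler_wpM2r ?expR_ge0//.
have d := dist_lipschitz l1 l2 t 0; rewrite subr0 in d.
have e1 : expR (- `|t|) * (1 + `|t|) <= 1.
  by rewrite expRN ler_pdivrMl ?expR_gt0// mulr1 expR_ge1Dx.
have e2 : expR (- `|t|) <= 1 by rewrite -expR0 ler_expR oppr_le0.
have e3 := expR_ge0 (- `|t|).
apply: (@le_trans _ _ ((mdist (h1 0) (h2 0) + 2 * `|t|) * expR (- `|t|))).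
  exact: ler_wpM2r.
rewrite mulrDl /C; apply: lerD; first by rewrite ler_piMr ?mdist_ge0.
by move: e1 e3; llra.
Qed.

(** Proximity for [dGX] forces uniform proximity on compact time intervals.
    Lifts exist and their weighted distance is integrable, so the infimum that
    defines [dGX] is finite and its real part is not a default value. The
    integrand being a Lipschitz function times the weight, a distance larger
    than [eps] at time [u] contributes at least [delta] to the integral. *)
Lemma dGX_uniform (n eps : R) : (forall y, exists x, p x = y) ->
  (forall x y, mdist (p x) (p y) <= mdist x y) -> 0 <= n -> 0 < eps ->
  exists2 delta : R, 0 < delta & forall g1 g2 : GX p, dGX p g1 g2 < delta ->
    forall u, `|u| <= n -> mdist (g1 u) (g2 u) <= eps.
Proof.
move=> psurj plip n0 eps0; have [rho0 _ inj] := injp.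
pose delta := eps / 2 * expR (- (2 * (n + eps))) * (eps / 2).
have e2 : 0 < eps / 2 by llra.
have delta0 : 0 < delta by rewrite /delta !mulr_gt0// expR_gt0.
exists delta => // g1 g2 d12 u un.
set S := [set e : \bar R | exists h1 h2 : R -> Xt,
    [/\ is_lift p h1 g1, is_lift p h2 g2 &
        e = (\int[lebesgue_measure]_(t in [set: R])
               (mdist (h1 t) (h2 t) * expR (- (2 * `|t|)))%:E)%E]].
have liftE (g : GX p) : exists h, is_lift p h g /\
    forall s t, mdist (h s) (h t) <= `|s - t|.
  have [x px] := psurj (g 0).
  have [h [_ ph hl]] := lipschitz_lift_exists injp (gx_loc_iso g) px.
  by exists h; split=> //; split=> //; exact: lipschitz_continuous.
have Slt : (ereal_inf S < +oo)%E.
  have [h1 [l1 L1]] := liftE g1; have [h2 [l2 L2]] := liftE g2.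
  apply: le_lt_trans (integral_weighted_dist_fin L1 L2).
  by apply: ereal_inf_lbound; exists h1, h2.
have S0 : (0 <= ereal_inf S)%E.
  apply: le_ereal_inf_tmp => _ [h1 [h2 [_ _ ->]]].
  by apply: integral_ge0 => t _; exact: weighted_dist_ge0.
have : (ereal_inf S < delta%:E)%E.
  by rewrite -(@fineK _ (ereal_inf S)) ?ge0_fin_numE.
move=> /ereal_inf_lt[_ [h1 [h2 [l1 l2 ->]]] Ilt].
have L1 := continuous_lift_lipschitz injp _ _ (gx_loc_iso g1) l1.
have L2 := continuous_lift_lipschitz injp _ _ (gx_loc_iso g2) l2.
have dh : mdist (h1 u) (h2 u) <= eps.
  rewrite leNgt; apply/negP => far; move: Ilt; apply/negP; rewrite -leNgt.
  pose D := `[u - eps / 4, u + eps / 4]%classic : set R.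
  have mD : measurable D by exact: measurable_itv.
  apply: (@le_trans _ _ (\int[mu]_(t in D) (weighted_dist h1 h2 t)%:E)%E); last first.
    apply: ge0_subset_integral => //.
      exact: weighted_dist_measurable.
    by move=> t _; exact: weighted_dist_ge0.
  apply: (@le_trans _ _ (\int[mu]_(t in D) cst (eps / 2 * expR (- (2 * (n + eps))))%:E t)%E).
    have muD : mu D = (eps / 2)%:E.
      rewrite /D lebesgue_measure_itv/= lte_fin ifT; last by llra.
      by rewrite -EFinB; congr (_%:E); field.
    rewrite integral_cst//; apply: (@le_trans _ _
      ((eps / 2 * expR (- (2 * (n + eps))))%:E * (eps / 2)%:E)%E).
      by rewrite -EFinM lee_fin.
    by rewrite -muD.
  apply: ge0_le_integral => //.
  - by move=> t _; rewrite lee_fin mulr_ge0 ?expR_ge0// ltW.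
  - by apply: measurable_funTS; exact: weighted_dist_measurable.
  move=> t /set_itvccP/andP[t1 t2]; rewrite lee_fin /weighted_dist.
  have ut : `|u - t| <= eps / 4 by rewrite ler_norml; apply/andP; split; llra.
  apply: ler_pM; rewrite ?expR_ge0//; first by rewrite ltW.
    by have := dist_lipschitz L1 L2 u t; move: far ut; llra.
  rewrite ler_expR lerN2 ler_pM2l//.
  have := ler_normD u (t - u); rewrite addrC subrK (distrC t u).
  by move: ut un eps0; llra.
by have [_ <-] := l1; have [_ <-] := l2; exact: le_trans (plip _ _) dh.
Qed.

End GeodesicFlowMetric.

(** * Failure of weak specification *)

Section NoWeakSpecification.
Context {R : realType} {X Xt : metricType R} (p : Xt -> X).
Context {rho : R} (injp : injectivity_radius p rho).

(** The geodesic of [X] covered by the line [g]. *)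
Definition projected_line (g : R -> Xt) (gl : geodesic_line g) : GX p :=
  MkGX p (projection_locally_isometric injp gl).

(** Two points travelling towards each other on a line meet at the parameter
    [(b - a) / 2]. They do not stay [eps]-close in [X] during the next unit of
    time, because their lifts, once close, would have to stay so. *)
Lemma opposite_lines_diverge (g : R -> Xt) (a b eps : R) : geodesic_line g ->
  eps < rho -> eps < 2 ->
  exists2 s, (b - a) / 2 <= s <= (b - a) / 2 + 1 &
    eps < mdist (p (g (a + s))) (p (g (b - s))).
Proof.
move=> gl er e2; have [rho0 _ inj] := injp.
have [//|H] := pselect (exists2 s, (b - a) / 2 <= s <= (b - a) / 2 + 1 &
    eps < mdist (p (g (a + s))) (p (g (b - s)))).
pose m := (b - a) / 2.
have lA s t : mdist (g (a + s)) (g (a + t)) <= `|s - t|.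
  by rewrite gl; have -> : a + s - (a + t) = s - t by ring.
have lB s t : mdist (g (b - s)) (g (b - t)) <= `|s - t|.
  by rewrite gl distrC; have -> : b - t - (b - s) = s - t by ring.
have mm : m <= m + 1 by llra.
have K : mdist (g (a + (m + 1))) (g (b - (m + 1))) <= eps.
  apply: (@track_lifts _ _ _ p rho injp m (m + 1) eps (fun s => g (a + s))
    (fun s => g (b - s))) => //.
  - exact: lipschitz_continuous_on.
  - exact: lipschitz_continuous_on.
  - move=> t tm; rewrite leNgt; apply/negP => far; apply: H.
    by exists t.
  - by rewrite gl; have -> : a + m - (b - m) = 0 by [rewrite /m; field]; rewrite normr0.
move: K; rewrite gl; have -> : a + (m + 1) - (b - (m + 1)) = 2 by rewrite /m; field.
by rewrite ger0_norm// leNgt e2.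
Qed.

Lemma fat_line_no_weak_specification (w : R) (g : R -> Xt) :
  (forall y, exists x, p x = y) ->
  (forall x y, mdist (p x) (p y) <= mdist x y) ->
  geodesic_line g -> 0 < w -> fat_line w g ->
  ~ weak_specification (dGX p) (geodesic_flow p).
Proof.
move=> psurj plip gl w0 fw spec.
have [rho0 lftp inj] := injp.
pose m := Num.min (Num.min rho w) 1.
have m0 : 0 < m by rewrite !lt_min rho0 w0 ltr01.
have [mr mw m1] : [/\ m <= rho, m <= w & m <= 1].
  by rewrite /m; split; rewrite !ge_min lexx ?orbT.
pose eps := m / 20; have eps0 : 0 < eps by rewrite /eps; llra.
have eE : m = 20 * eps by rewrite /eps; field.
clearbody eps; rewrite {}eE in m0 mr mw m1.
have [delta delta0 Hd] := dGX_uniform injp psurj plip (lexx 0) eps0.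
have [tau tau0 Htau] := spec delta delta0.
pose L := 2 * tau + 2; have L0 : 0 < L by rewrite /L; llra.
pose T := 4 * L + 16 * L ^+ 2 / eps.
have q0 : 0 <= 16 * L ^+ 2 / eps by rewrite divr_ge0 ?mulr_ge0 ?sqr_ge0// ltW.
have LT : 4 * L <= T by rewrite /T; llra.
have LT2 : 16 * L ^+ 2 <= T * eps.
  have -> : T * eps = 4 * L * eps + 16 * L ^+ 2 by rewrite /T; field; rewrite gt_eqF.
  by rewrite lerDr !mulr_ge0// ltW.
have T0 : 0 < T by llra.
clearbody T.
pose B := T + 2 * tau.
have gBl : geodesic_line (fun u => g (B - u)).
  by move=> s t; rewrite gl distrC; congr (`|_|); ring.
(* [g] during the time [T], then [g] backwards from [B]: whatever the gap
   [taus 1] in [0, tau], the two motions meet at a time in [tau / 2, tau] *)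
pose x i := if i == 1%N then projected_line gl else projected_line gBl.
pose t i := if i == 1%N then T else tau + 2.
have [|y [taus [taus0 taus1 Hy]]] := Htau 2%N x t isT.
  by move=> i _; rewrite /t; case: ifP => _; llra.
have /andP[tau1 tau2] := taus1 1%N isT.
have near1 s : 0 <= s -> s <= T -> mdist (y s) (p (g s)) <= eps.
  move=> s0 sT; have := Hy 1%N isT s; rewrite /t/= => /(_ _)/Hd.
  rewrite s0 sT => /(_ isT 0); rewrite normr0 => /(_ (lexx _)) /=.
  by rewrite big_geq// big_geq// taus0 !addr0 add0r.
have near2 s : 0 <= s -> s <= tau + 2 ->
    mdist (y (T + taus 1%N + s)) (p (g (B - s))) <= eps.
  move=> s0 sT; have := Hy 2%N isT s; rewrite /t/= => /(_ _)/Hd.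
  rewrite s0 sT => /(_ isT 0); rewrite normr0 => /(_ (lexx _)) /=.
  rewrite big_nat1/= big_geq// addr0 add0r.
  by have -> : s + (T + taus 1%N) = T + taus 1%N + s by ring.
have [|z pz gz] := lftp (g 0) (y 0).
  by rewrite metric_sym; apply: le_lt_trans (near1 0 (lexx _) (ltW T0)) _; llra.
have [yt [ytz pyt ytl]] := lipschitz_lift_exists injp (gx_loc_iso y) pz.
have yti := lift_locally_isometric injp (gx_loc_iso y) pyt ytl.
have gl1 s u : mdist (g s) (g u) <= `|s - u| by rewrite gl.
have up s : 0 <= s -> s <= T -> mdist (yt s) (g s) <= eps.
  move=> s0 sT.
  apply: (@track_lifts _ _ _ p rho injp 0 s eps yt g) => //.
  - by llra.
  - exact: lipschitz_continuous_on.
  - exact: lipschitz_continuous_on.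
  - by move=> u /andP[u0 us]; rewrite pyt; apply: near1 => //; llra.
  - rewrite ytz metric_sym gz metric_sym.
    by apply: le_lt_trans (near1 0 (lexx _) (ltW T0)) _; llra.
have ew : 5 * eps < w by llra.
have up2 := fat_line_shadowing_extends fw yti eps0 ew L0 LT LT2 up gl1.
have [||s /andP[s1 s2]] :=
  @opposite_lines_diverge g (T + taus 1%N) B (4 * eps) gl; [by llra|by llra|].
rewrite /B in s1 s2 *.
apply/negP; rewrite -leNgt.
apply: le_trans (metric_triangle _ (y (T + taus 1%N + s)) _) _.
have h2 : mdist (y (T + taus 1%N + s)) (p (g (T + 2 * tau - s))) <= eps.
  by apply: near2; llra.
have h1 : mdist (yt (T + taus 1%N + s)) (g (T + taus 1%N + s)) <= 3 * eps.
  by apply: up2; rewrite /L; llra.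
have := plip (g (T + taus 1%N + s)) (yt (T + taus 1%N + s)).
by rewrite pyt (metric_sym (g _)); llra.
Qed.

End NoWeakSpecification.

(** * Compactness of subshifts and splicing *)

Section Compactness.

Lemma compact_sequence_cluster (K : topologicalType) (q : nat -> K) :
  compact [set: K] ->
  exists z : K, forall U : set K, nbhs z U -> forall N, exists2 n, (N <= n)%N & U (q n).
Proof.
move=> cK; have [z [_ clz]] := cK (q @ \oo) _ (filterT).
exists z => U zU N.
have [|_ [[n Nn <-] Uqn]] := clz (q @` [set n | (N <= n)%N]) U _ zU.
  by exists N => // n Nn; exists n.
by exists n.
Qed.

Lemma compact_set_type (T : topologicalType) (C : set T) :
  compact C -> compact [set: set_type C].
Proof.
move=> /compact_near_coveringP/near_covering_withinP cC.
apply/compact_near_coveringP => I G P GF HP.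
pose P' i (t : T) := forall h : t \in C, P i (exist _ t h).
have := cC I G P' GF.
have H : forall x, C x -> \forall x' \near x & i \near G, C x' -> P' i x'.
  move=> x Cx; have [[U V] /= [nU GV] UV] := HP (exist _ x (mem_set Cx)) Logic.I.
  move: nU => [_ [[W oW <-] /= Wx] WU].
  exists (W, V) => /=; first by split=> //; exact: open_nbhs_nbhs.
  move=> [x' i] [/= Wx' Vi] _ h; apply: (UV (exist _ x' h, i)); split=> //=.
  by apply: WU.
move=> /(_ H); apply: filterS => i Hi [t ht] _.
by apply: Hi; exact: set_mem.
Qed.

End Compactness.

Section ShiftSpace.
Context (A : finType) (F : seq (seq A)).

Lemma full_shift_coordinate (x : full_shift A) (k : int) :
  nbhs x [set y : full_shift A | y k = x k].
Proof.
have : nbhs (x k : discrete_topology A) [set x k] by [].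
exact: (@proj_continuous int (fun _ => discrete_topology A) k x).
Qed.

(** Equality of the coordinates of index at most [m] in absolute value. *)
Definition agree (m : nat) (x y : full_shift A) : Prop :=
  forall k : int, `|k| <= m%:Z -> x k = y k.

Lemma full_shift_cylinder (x : full_shift A) (m : nat) : nbhs x (agree m x).
Proof.
have : nbhs x [set y : full_shift A | forall i : 'I_(m.*2.+1),
    y (i%:Z - m%:Z) = x (i%:Z - m%:Z)].
  apply: (@filter_forall _ _ (fun (i : 'I_(m.*2.+1)) (y : full_shift A) =>
    y (i%:Z - m%:Z) = x (i%:Z - m%:Z)) (nbhs x)) => i.
  exact: full_shift_coordinate.
apply: filterS => y Hy k km.
have kk : (absz (k + m%:Z)%R < m.*2.+1)%N by lia.
have := Hy (Ordinal kk) => /= /esym.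
by have -> : (absz (k + m%:Z)%R)%:Z - m%:Z = k by lia.
Qed.

Lemma full_shift_compact : compact [set: full_shift A].
Proof.
have := @tychonoff int (fun _ => discrete_topology A) (fun _ => setT).
have h : forall i : int, compact [set: discrete_topology A].
  by move=> _; apply: finite_compact; exact: finite_finset.
move=> /(_ h); rewrite (_ : [set f | _] = setT)//.
by apply/seteqP; split.
Qed.

Lemma SFT_closed : closed (SFT F).
Proof.
move=> x clx w wF k wk.
have : nbhs x [set y : full_shift A | forall i : 'I_(size w), y (k + i%:Z) = x (k + i%:Z)].
  apply: (@filter_forall _ _ (fun (i : 'I_(size w)) (y : full_shift A) =>
    y (k + i%:Z) = x (k + i%:Z)) (nbhs x)) => i.
  exact: full_shift_coordinate.
move=> /clx[y [Fy yx]]; apply: (Fy w wF k) => i.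
by rewrite yx; exact: wk.
Qed.

Lemma SFT_compact : compact [set: SFT F].
Proof.
apply: compact_set_type; apply: subclosed_compact full_shift_compact _ => //.
exact: SFT_closed.
Qed.

Lemma SFT_cylinder (x : SFT F) (m : nat) :
  nbhs (x : SFT F) [set y : SFT F | agree m (\val x) (\val y)].
Proof.
exact: (@initial_continuous _ _ (\val : SFT F -> full_shift A) x _
  (full_shift_cylinder (\val x) m)).
Qed.

Lemma unit_itv_compact (R : realType) : compact [set: unit_itv R].
Proof. by apply: compact_set_type; exact: segment_compact. Qed.

(** Maps on [Sigma x [0, 1]] depend uniformly on the central coordinates. *)
Lemma box_uniform_continuity (R : realType) (X : metricType R) (f : box R F -> X)
    (eps : R) : continuous f -> 0 < eps ->
  exists m, forall x y i, agree m (\val x) (\val y) ->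
    mdist (f (x, i)) (f (y, i)) <= eps.
Proof.
move=> cf eps0.
have [//|H] := pselect (exists m, forall x y i, agree m (\val x) (\val y) ->
    mdist (f (x, i)) (f (y, i)) <= eps).
have /choice[q Hq] : forall m, exists q : SFT F * SFT F * unit_itv R,
    agree m (\val q.1.1) (\val q.1.2) /\ eps < mdist (f (q.1.1, q.2)) (f (q.1.2, q.2)).
  move=> m; have [//|H2] := pselect (exists q : SFT F * SFT F * unit_itv R,
    agree m (\val q.1.1) (\val q.1.2) /\ eps < mdist (f (q.1.1, q.2)) (f (q.1.2, q.2))).
  exfalso; apply: H; exists m => x y i xy; rewrite leNgt; apply/negP => far.
  by apply: H2; exists (x, y, i).
have cK : compact [set: SFT F * SFT F * unit_itv R].
  rewrite -setXTT -(setXTT (SFT F)); apply: compact_setX; last exact: unit_itv_compact.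
  by apply: compact_setX; exact: SFT_compact.
have [[[x y] i] cl] := compact_sequence_cluster q cK.
have xy : x = y.
  apply: val_inj; apply/funext => k.
  have [|n kn [[/= ex ey] _]] := cl [set z | (agree (absz k) (\val x) (\val z.1.1) /\
      agree (absz k) (\val y) (\val z.1.2)) /\ True] _ (absz k).
    exists ([set z : SFT F * SFT F | agree (absz k) (\val x) (\val z.1) /\
      agree (absz k) (\val y) (\val z.2)], setT) => //=.
    split; last exact: filterT.
    exists ([set z | agree (absz k) (\val x) (\val z)],
      [set z | agree (absz k) (\val y) (\val z)]) => //.
    by split; exact: SFT_cylinder.
  have kk : `|k| <= (absz k)%:Z by lia.
  have kn' : `|k| <= n%:Z by lia.
  by rewrite ex// ey//; have [a _] := Hq n; exact: a.
subst y.
have fball : nbhs (x, i) [set z | mdist (f (x, i)) (f z) < eps / 2].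
  apply: (cf (x, i) [set z | mdist (f (x, i)) z < eps / 2]).
  by apply/nbhs_mdist; exists (eps / 2) => //; rewrite divr_gt0.
have [[U V] /= [nU nV] UV] := fball.
have [|n _ [[/= U1 U2] V3]] := cl [set z | (U z.1.1 /\ U z.1.2) /\ V z.2] _ 0%N.
  exists ([set z : SFT F * SFT F | U z.1 /\ U z.2], V) => //; split=> //.
  by exists (U, U).
have [_] := Hq n; rewrite ltNge => /negP[].
have h1 : mdist (f (x, i)) (f ((q n).1.1, (q n).2)) < eps / 2 by apply: UV.
have h2 : mdist (f (x, i)) (f ((q n).1.2, (q n).2)) < eps / 2 by apply: UV.
have := metric_triangle (f ((q n).1.1, (q n).2)) (f (x, i)) (f ((q n).1.2, (q n).2)).
by rewrite (metric_sym (f ((q n).1.1, (q n).2)) (f (x, i))); llra.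
Qed.

End ShiftSpace.

Section Splicing.
Context (A : finType) (F : seq (seq A)).

(** The maximal length of the forbidden words. *)
Definition memory : nat := \max_(w <- F) size w.

(** Splicing two points of the shift along a third one, which agrees with them
    on windows at least as long as the forbidden words. *)
Lemma SFT_splice (x1 x2 z : SFT F) (K m : nat) : (memory <= m)%N ->
  agree m (\val x1) (\val z) -> agree m (\val x2) (shiftZ K%:Z (\val z)) ->
  exists x : SFT F, (forall k : int, k <= 0 -> \val x k = \val x1 k) /\
    (forall k : int, K%:Z <= k -> \val x k = \val x2 (k - K%:Z)).
Proof.
move=> Mm a1 a2.
pose y : full_shift A := fun k : int =>
  if k <= 0 then \val x1 k else if k < K%:Z then \val z k else \val x2 (k - K%:Z).
have y1 (k : int) : k <= 0 -> y k = \val x1 k by rewrite /y => ->.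
have y2 (k : int) : K%:Z <= k -> y k = \val x2 (k - K%:Z).
  rewrite /y => Kk; case: ifPn => [k0|_]; last by rewrite ltNge Kk.
  have [k0' K0] : k = 0 /\ K = 0%N by lia.
  subst K; rewrite k0' subr0; have a10 := a1 0 ltac:(lia).
  by have := a2 0 ltac:(lia); rewrite /shiftZ addr0 a10 => ->.
have y3 (k : int) : - m%:Z <= k -> k <= K%:Z + m%:Z -> y k = \val z k.
  move=> km kK; rewrite /y; case: ifPn => [k0|k0]; first by apply: a1; lia.
  case: ifPn => [//|kK']; rewrite a2; last by lia.
  by rewrite /shiftZ subrK.
have Fy : SFT F y.
  move=> w wF k wk.
  have sw : (size w <= m)%N.
    have h : (size w <= memory)%N by exact: (@leq_bigmax_seq _ _ xpredT size w wF isT).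
    exact: leq_trans h Mm.
  pose n := size w; have iE (i : 'I_(size w)) : (i < n)%N by exact: ltn_ord.
  have {sw} : (n <= m)%N by [].
  clearbody n => nm.
  have [k1|k1] := leP (k + n%:Z) 1.
    apply: (set_valP x1 w wF k) => i; rewrite -wk y1//.
    by move: (iE i) => /=; lia.
  have [k2|k2] := leP K%:Z k.
    apply: (set_valP x2 w wF (k - K%:Z)) => i; rewrite -wk y2; last by lia.
    by rewrite addrAC.
  by apply: (set_valP z w wF k) => i; rewrite -wk y3//; move: (iE i) => /=; lia.
by exists (exist _ y (mem_set Fy)).
Qed.

Lemma agree_past (m n : nat) (x y : SFT F) : (m <= n)%N ->
  (forall k : int, k <= 0 -> \val x k = \val y k) ->
  agree m (\val (SFT_shift (- n.+1%:Z) x)) (\val (SFT_shift (- n.+1%:Z) y)).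
Proof. by move=> mn xy k km; rewrite /= /shiftZ xy//; lia. Qed.

Lemma agree_future (m n K : nat) (x y : SFT F) : (m <= n)%N ->
  (forall k : int, K%:Z <= k -> \val x k = \val y (k - K%:Z)) ->
  agree m (\val (SFT_shift n%:Z y)) (\val (SFT_shift n%:Z (SFT_shift K%:Z x))).
Proof.
move=> mn xy k km; rewrite /= /shiftZ xy; last by lia.
by congr (\val y _); lia.
Qed.

End Splicing.

(** * Changes of time along an orbit semi-equivalence *)

Section RealContinuity.
Context {R : realType}.

Lemma within_continuous_real (a b : R) (f : R -> R) :
  {within `[a, b]%classic, continuous f} <->
  (forall t, a <= t <= b -> forall eps, 0 < eps -> exists2 e : R, 0 < e &
    forall s, a <= s <= b -> `|s - t| < e -> `|f s - f t| < eps).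
Proof.
rewrite subspace_continuousP; split=> H t tab.
- move=> eps eps0.
  have tab' : `[a, b]%classic t by apply/set_itvccP.
  have : nbhs (f t) [set r : R | `|r - f t| < eps] by apply/nbhs_real; exists eps.
  move=> /(H t tab'); rewrite /nbhs/= /within/= => /nbhs_real[e e0 He].
  by exists e => // s sab st; apply: He => //; exact/set_itvccP.
- move=> B /nbhs_real[eps eps0 He].
  have tab' : a <= t <= b by exact/set_itvccP.
  have [e e0 Hd] := H t tab' eps eps0.
  apply/nbhs_real; exists e => // s st /set_itvccP sab.
  by apply: He; exact: Hd.
Qed.

Lemma within_continuous_glue (a s b : R) (f g : R -> R) : a <= s -> s <= b ->
  {within `[a, s]%classic, continuous f} ->
  {within `[s, b]%classic, continuous g} -> f s = g s ->
  {within `[a, b]%classic, continuous (fun r => if r <= s then f r else g r)}.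
Proof.
move=> as_ sb /within_continuous_real cf /within_continuous_real cg fg.
apply/within_continuous_real => t /andP[at_ tb] eps eps0.
have [ts|st] := ltP t s.
  have tas : a <= t <= s by rewrite at_ ltW.
  have [e e0 He] := cf t tas eps eps0.
  exists (Num.min e (s - t)); first by rewrite lt_min e0 subr_gt0.
  move=> r /andP[ar rb]; rewrite lt_min => /andP[re rst].
  have rs : r <= s by move: rst; rewrite ltr_norml => /andP[_ ?]; llra.
  by rewrite rs (ltW ts); apply: He => //; rewrite ar.
have tsb : s <= t <= b by rewrite st.
have [e e0 He] := cg t tsb eps eps0.
have [tEs|tNs] := eqVneq t s.
  subst t; have sas : a <= s <= s by rewrite as_ lexx.
  have [e' e0' He'] := cf s sas eps eps0.
  exists (Num.min e e'); first by rewrite lt_min e0.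
  move=> r /andP[ar rb]; rewrite lt_min lexx => /andP[re re'].
  have [rs|sr] := leP r s; first by apply: He' => //; rewrite ar.
  by rewrite fg; apply: He => //; rewrite (ltW sr).
have lst : s < t by rewrite lt_neqAle eq_sym tNs.
exists (Num.min e (t - s)); first by rewrite lt_min e0 subr_gt0.
move=> r /andP[ar rb]; rewrite lt_min => /andP[re rst].
have sr : s < r by move: rst; rewrite ltr_norml => /andP[? _]; llra.
rewrite !leNgt sr lst /=; apply: He => //; by rewrite (ltW sr).
Qed.

End RealContinuity.

Section TimeChange.
Local Open Scope quotient_scope.
Context {R : realType} {X Xt : metricType R} (p : Xt -> X).
Context {rho : R} (injp : injectivity_radius p rho).
Context (psurj : forall y, exists x, p x = y).
Context (plip : forall x y, mdist (p x) (p y) <= mdist x y).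
Context (A : finType) (F : seq (seq A)) (h : Susp R F -> GX p).
Context (ose : orbit_semi_equivalence (susp_flow R A F) (geodesic_flow p) h).

(** The sets of geodesics close to [y] at time [u] are open; this does not need
    the triangle inequality for [dGX]. *)
Lemma GX_evaluation_open (y : GX p) (u eps : R) :
  open [set g : GX p | mdist (y u) (g u) < eps].
Proof.
move=> g /= yg; have e0 : 0 < (eps - mdist (y u) (g u)) / 2 by llra.
have [d d0 Hd] := dGX_uniform injp psurj plip (normr_ge0 u) e0.
exists d => // g' /Hd /(_ u (lexx _)) gg'.
by have := metric_triangle (y u) (g u) (g' u); llra.
Qed.

Lemma GX_evaluation_continuous (u : R) : continuous (fun g : GX p => g u).
Proof.
move=> g B /nbhs_mdist[e e0 He].
have : nbhs g [set g' : GX p | mdist (g u) (g' u) < e].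
  apply: open_nbhs_nbhs; split; first exact: GX_evaluation_open.
  by rewrite /= mdistxx.
by apply: filterS => g'; exact: He.
Qed.

Lemma clamp_in01 (r : R) : `[0, 1]%classic (Num.max 0 (Num.min r 1)).
Proof.
apply/set_itvccP; rewrite le_max lexx /= ge_max ler01 /=.
by rewrite ge_min lexx orbT.
Qed.

(** A real number as a height of the suspension, clamped to [0, 1]. *)
Definition itv01 (r : R) : unit_itv R :=
  exist (fun x => x \in (`[0, 1]%classic : set R)) _ (mem_set (clamp_in01 r)).

Lemma itv01E (r : R) : 0 <= r -> r <= 1 -> \val (itv01 r) = r.
Proof. by move=> r0 r1; rewrite /= (min_idPl r1) (max_idPr r0). Qed.

Lemma itv01K (i : unit_itv R) : itv01 (\val i) = i.
Proof.
have /set_itvccP/andP[i0 i1] := set_valP i.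
by apply: val_inj; rewrite itv01E.
Qed.

(** The geodesic over the point of base [x] and height [r] in [0, 1]. *)
Definition leaf (x : SFT F) (r : R) : GX p := h (\pi_(Susp R F) ((x, itv01 r) : box R F)).

Lemma leaf_roof x : leaf x 1 = leaf (SFT_shift 1 x) 0.
Proof.
rewrite /leaf; congr h; apply/eqmodP/asboolP/rst_step; split=> //.
- by rewrite itv01E.
- by rewrite itv01E.
Qed.

Lemma evaluation_box_continuous (u : R) :
  continuous (fun z : box R F => h (\pi_(Susp R F) z) u).
Proof.
have [hc _ _] := ose; move=> z.
apply: (@continuous_comp _ _ _ (fun z : box R F => h (\pi_(Susp R F) z))
  (fun g : GX p => g u)); last exact: GX_evaluation_continuous.
apply: (@continuous_comp _ _ _ (fun z : box R F => \pi_(Susp R F) z) h);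
  last exact: hc.
exact: pi_continuous.
Qed.

Lemma leaf_uniform (u eps : R) : 0 < eps ->
  exists m, forall x y r, agree m (\val x) (\val y) ->
    mdist (leaf x r u) (leaf y r u) <= eps.
Proof.
move=> eps0.
have [m Hm] := box_uniform_continuity (@evaluation_box_continuous u) eps0.
by exists m => x y r xy; exact: Hm.
Qed.

(** The orbit semi-equivalence near the point of base [x] and height [t]. *)
Lemma leaf_local_time (x : SFT F) (t : R) : 0 <= t -> t <= 1 ->
  exists2 e : R, 0 < e & exists a : R -> R, [/\ a 0 = 0,
    forall s, - e < s -> s < e -> forall eps, 0 < eps -> exists2 d : R, 0 < d &
      forall r, - e < r -> r < e -> `|r - s| < d -> `|a r - a s| < eps,
    forall s r, - e < s -> s < r -> r < e -> a s < a r &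
    forall s u, - e < s -> s < e -> 0 <= t + s -> t + s <= 1 ->
      leaf x (t + s) u = leaf x t (u + a s)].
Proof.
move=> t0 t1; have [_ _ /(_ (\pi_(Susp R F) ((x, itv01 t) : box R F)))] := ose.
move=> [_ [e [a [e0 [a0 ac ai af _]]]]]; exists e => //; exists a.
have ine s : - e < s -> s < e -> s \in `]- e, e[ by move=> s1 s2; rewrite in_itv/= s1.
split=> // [s s1 s2 eps eps0|s r s1 sr r1|s u s1 s2 ts0 ts1].
- have /subspace_continuousP/(_ s) := ac.
  have sin : `]- e, e[%classic s by rewrite /= in_itv/= s1.
  move=> /(_ sin); have : nbhs (a s) [set r : R | `|r - a s| < eps].
    by apply/nbhs_real; exists eps.
  move=> /[swap] /[apply]; rewrite /nbhs/= /within/= => /nbhs_real[d d0 Hd].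
  by exists d => // r r1 r2 rs; apply: Hd => //; rewrite in_itv/= r1.
- by apply: ai => //; apply: ine => //; llra.
- have := af s (ine s s1 s2).
  rewrite (@susp_flow_local R A F s x (itv01 t) (itv01 (t + s))) ?itv01E//.
  by rewrite /leaf => ->.
Qed.

(** [b] is a change of time over the fibre of [x], from height 0 to height 1. *)
Definition time_piece (x : SFT F) (b : R -> R) : Prop :=
  [/\ {within `[0, 1]%classic, continuous b}, b 0 = 0,
      forall s t, 0 <= s -> s <= t -> t <= 1 -> b s <= b t &
      forall s u, 0 <= s -> s <= 1 -> leaf x s u = leaf x 0 (u + b s)].

Lemma time_piece_exists x : exists b, time_piece x b.
Proof.
pose P w := exists b : R -> R, [/\ {within `[0, w]%classic, continuous b}, b 0 = 0,
    forall s t, 0 <= s -> s <= t -> t <= w -> b s <= b t &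
    forall s u, 0 <= s -> s <= w -> leaf x s u = leaf x 0 (u + b s)].
suff : P 1 by [].
apply: (@real_induction _ 0 1 P) => //.
  exists (fun=> 0); split=> //.
    by apply: continuous_subspaceT => t; exact: cvg_cst.
  move=> s u s0 s0'; have -> : s = 0 by apply/eqP; rewrite eq_le s0 s0'.
  by rewrite addr0.
move=> t /andP[t0 t1]; have [e e0 [a [a0 ac ai af]]] := leaf_local_time x t0 t1.
exists e => // s w /andP[s0 st] /andP[tw w1] tes wte [b [bc b0 bi bf]].
have ws : s <= w by exact: le_trans st tw.
pose g r := b s + (a (r - t) - a (s - t)).
have ain r : s <= r -> r <= w -> - e < r - t /\ r - t < e.
  by move=> sr rw; split; llra.
have alt r r' : s <= r -> r <= r' -> r' <= w -> a (r - t) <= a (r' - t).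
  move=> sr; rewrite le_eqVlt => /predU1P[-> //|rr'] r'w; apply: ltW; apply: ai; llra.
exists (fun r => if r <= s then b r else g r); split.
- apply: within_continuous_glue => //; last by rewrite /g subrr addr0.
  apply/within_continuous_real => z /andP[sz zw] eps eps0.
  have [z1 z2] := ain z sz zw.
  have [d d0 Hd] := ac _ z1 z2 eps eps0; exists d => // r /andP[sr rw] rz.
  have [r1 r2] := ain r sr rw.
  have -> : g r - g z = a (r - t) - a (z - t) by rewrite /g; ring.
  apply: Hd => //; by have -> : r - t - (z - t) = r - z by ring.
- by rewrite s0.
- move=> r r' r0 rr' r'w; have [r's|sr'] := leP r' s.
    by rewrite (le_trans rr' r's); exact: bi.
  have [rs|sr] := leP r s.
    apply: (@le_trans _ _ (b s)); first exact: bi.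
    by rewrite /g lerDl subr_ge0; apply: alt => //; exact: ltW.
  by rewrite /g lerD2l lerD2r; apply: alt => //; exact: ltW.
- move=> r u r0 rw; have [rs|sr] := leP r s; first exact: bf.
  have [r1 r2] := ain r (ltW sr) rw; have [s1 s2] := ain s (lexx _) ws.
  have e1 := af (r - t) u r1 r2; rewrite addrC subrK in e1.
  have e2 := af (s - t) (u + a (r - t) - a (s - t)) s1 s2; rewrite addrC subrK in e2.
  rewrite e1; [|by []|llra].
  have e3 := bf s (u + a (r - t) - a (s - t)) s0 (lexx _).
  move: e2; rewrite subrK => <-; [|by []|llra].
  by rewrite e3; congr (leaf x 0 _); rewrite /g; ring.
Qed.

(** By compactness, crossing the suspension takes a time bounded below:
    otherwise some orbit is constant along a fibre, which is impossible because
    a local geodesic has no arbitrarily small period. *)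
Lemma time_piece_lower_bound :
  exists2 c : R, 0 < c & forall x b, time_piece x b -> c <= b 1.
Proof.
have [//|H] := pselect (exists2 c : R, 0 < c & forall x b, time_piece x b -> c <= b 1).
have /choice[q Hq] : forall n : nat, exists q : SFT F * (R -> R),
    time_piece q.1 q.2 /\ q.2 1 < n.+1%:R^-1.
  move=> n; have [//|H2] := pselect (exists q : SFT F * (R -> R),
    time_piece q.1 q.2 /\ q.2 1 < n.+1%:R^-1).
  exfalso; apply: H; exists (n.+1%:R^-1); first by rewrite invr_gt0.
  move=> x b xb; rewrite leNgt; apply/negP => lt; apply: H2; by exists (x, b).
have [x cl] := compact_sequence_cluster (fun n => (q n).1) (@SFT_compact A F).
have still s u : 0 <= s -> s <= 1 -> leaf x s u = leaf x 0 u.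
  move=> s0 s1; apply/mdist_positivity/eqP; rewrite eq_le mdist_ge0 andbT.
  apply/ler_addgt0Pl => eps eps0; rewrite addr0.
  have e3 : 0 < eps / 3 by llra.
  have [m Hm] := leaf_uniform u e3.
  have [n nN xn] := cl _ (SFT_cylinder x m) (Num.truncn (eps / 3)^-1).
  have n3 : n.+1%:R^-1 < eps / 3.
    rewrite invf_plt ?posrE//.
    have e30 : 0 <= (eps / 3)^-1 by rewrite invr_ge0 ltW.
    have /andP[_ h1] := truncn_itv e30.
    by apply: lt_le_trans h1 _; rewrite ler_nat ltnS.
  have [[_ b0 bi bf] b1] := Hq n.
  have d1 := Hm _ _ s xn; have d2 := Hm _ _ 0 xn.
  have d3 : mdist (leaf (q n).1 s u) (leaf (q n).1 0 u) <= eps / 3.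
    rewrite bf//; apply: le_trans (locally_isometric_lipschitz _ _ (gx_loc_iso _)) _.
    have -> : u + (q n).2 s - u = (q n).2 s by ring.
    have bs0 : 0 <= (q n).2 s by rewrite -b0; exact: bi.
    rewrite ger0_norm//; apply: ltW; apply: le_lt_trans (lt_trans b1 n3).
    exact: bi.
  have h1 := metric_triangle (leaf x s u) (leaf (q n).1 s u) (leaf x 0 u).
  have h2 := metric_triangle (leaf (q n).1 s u) (leaf (q n).1 0 u) (leaf x 0 u).
  by rewrite (metric_sym (leaf (q n).1 0 u) (leaf x 0 u)) in h2; move: h1 h2 d1 d2 d3; llra.
have [e e0 [a [a0 ac ai af]]] := leaf_local_time x (lexx 0) ler01.
have [e' e'0 He'] := gx_loc_iso (leaf x 0) 0.
have e00 : - e < 0 by llra.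
have [d d0 Hd] := ac 0 e00 e0 e' e'0.
pose s := Num.min (Num.min e d) 1 / 2.
have m0 : 0 < Num.min (Num.min e d) 1 by rewrite !lt_min e0 d0 ltr01.
have s0 : 0 < s by rewrite /s; llra.
have [se sd s1] : [/\ s < e, s < d & s < 1].
  have k1 : Num.min (Num.min e d) 1 <= e by rewrite !ge_min lexx.
  have k2 : Num.min (Num.min e d) 1 <= d by rewrite !ge_min lexx orbT.
  have k3 : Num.min (Num.min e d) 1 <= 1 by rewrite !ge_min lexx orbT.
  by rewrite /s; split; llra.
have as0 : 0 < a s by rewrite -a0; apply: ai.
have ase : `|a s - 0| < e'.
  by rewrite -a0; apply: Hd => //; rewrite ?subr0 ?ger0_norm//; llra.
have k : leaf x s 0 = leaf x 0 (a s).
  by have := af s 0; rewrite !add0r; apply; llra.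
have := still s 0 (ltW s0) (ltW s1); rewrite k.
move=> eq0; have := He' (a s) 0 ase; rewrite subrr normr0 => /(_ e'0).
by rewrite eq0 mdistxx subr0 ger0_norm ?(ltW as0)// => z; rewrite -z ltxx in as0.
Qed.

End TimeChange.

Section Itinerary.
Context {R : realType} {X Xt : metricType R} (p : Xt -> X).
Context (A : finType) (F : seq (seq A)) (h : Susp R F -> GX p) (c : R).
Context (tp : forall x, exists b, time_piece h x b).
Context (tpc : forall x b, time_piece h x b -> c <= b 1).

Lemma SFT_shiftD (m n : int) (x : SFT F) :
  SFT_shift m (SFT_shift n x) = SFT_shift (m + n) x.
Proof.
by apply: val_inj; apply/funext => k; rewrite /= /shiftZ addrA.
Qed.

Lemma SFT_shift0 (x : SFT F) : SFT_shift 0 x = x.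
Proof. by apply: val_inj; apply/funext => k; rewrite /= /shiftZ addr0. Qed.

(** The forward orbit of [(x, 0)], with the time changes on its successive
    crossings of the suspension. *)
Lemma forward_times (x : SFT F) : exists beta : nat -> R -> R,
  [/\ forall n, {within `[0, 1]%classic, continuous (beta n)}, beta 0%N 0 = 0,
      forall n, beta n 1 = beta n.+1 0, forall n, beta n 0 + c <= beta n 1 &
      forall n s u, 0 <= s -> s <= 1 ->
        leaf h (SFT_shift n%:Z x) s u = leaf h x 0 (u + beta n s)].
Proof.
have /choice[B HB] := tp.
pose tau := fix T n : R := if n is m.+1 then T m + B (SFT_shift m%:Z x) 1 else 0.
have B0 y : B y 0 = 0 by have [] := HB y.
have tauP n u : leaf h (SFT_shift n%:Z x) 0 u = leaf h x 0 (u + tau n).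
  elim: n u => [|n IH] u; first by rewrite SFT_shift0 addr0.
  have -> : SFT_shift n.+1%:Z x = SFT_shift 1 (SFT_shift n%:Z x).
    by rewrite SFT_shiftD; congr SFT_shift; lia.
  rewrite -leaf_roof; have [_ _ _ ->//] := HB (SFT_shift n%:Z x).
  by rewrite IH /=; congr (leaf h x 0 _); ring.
exists (fun n s => tau n + B (SFT_shift n%:Z x) s); split.
- move=> n; apply/within_continuous_real => t tab eps eps0.
  have [/within_continuous_real/(_ t tab eps eps0)[e e0 He] _ _ _] := HB (SFT_shift n%:Z x).
  exists e => // s sab st; rewrite opprD addrACA subrr add0r; exact: He.
- by rewrite /= B0 addr0.
- by move=> n; rewrite /= B0 addr0.
- move=> n; rewrite B0 addr0 lerD2l; exact: tpc.
- move=> n s u s0 s1; have [_ _ _ ->//] := HB (SFT_shift n%:Z x).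
  by rewrite tauP; congr (leaf h x 0 _); ring.
Qed.

(** The same along the backward orbit, run backwards. *)
Lemma backward_times (x : SFT F) : exists beta : nat -> R -> R,
  [/\ forall n, {within `[0, 1]%classic, continuous (beta n)},
      forall n, beta n 1 = beta n.+1 0, forall n, beta n 0 + c <= beta n 1 &
      forall n s u, 0 <= s -> s <= 1 ->
        leaf h (SFT_shift (- n.+1%:Z) x) (1 - s) u = leaf h x 0 (u - beta n s)].
Proof.
have /choice[B HB] := tp.
pose tau := fix T n : R := if n is m.+1 then T m + B (SFT_shift (- n%:Z) x) 1 else 0.
have B0 y : B y 0 = 0 by have [] := HB y.
have tauP n u : leaf h (SFT_shift (- n%:Z) x) 0 u = leaf h x 0 (u - tau n).
  elim: n u => [|n IH] u; first by rewrite SFT_shift0 subr0.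
  have e : SFT_shift (- n%:Z) x = SFT_shift 1 (SFT_shift (- n.+1%:Z) x).
    by rewrite SFT_shiftD; congr SFT_shift; lia.
  have [_ _ _ H] := HB (SFT_shift (- n.+1%:Z) x).
  have := H 1 (u - B (SFT_shift (- n.+1%:Z) x) 1) ler01 (lexx _).
  rewrite subrK => <-; rewrite leaf_roof -e IH.
  by congr (leaf h x 0 _); rewrite /=; ring.
exists (fun n s => tau n.+1 - B (SFT_shift (- n.+1%:Z) x) (1 - s)); split.
- move=> n; apply/within_continuous_real => t /andP[t0 t1] eps eps0.
  have t01 : 0 <= 1 - t <= 1 by apply/andP; split; lra.
  have [/within_continuous_real/(_ _ t01 eps eps0)[e e0 He] _ _ _] :=
    HB (SFT_shift (- n.+1%:Z) x).
  exists e => // s /andP[s0 s1] st.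
  set a := B _ (1 - s); set b := B _ (1 - t); set z := tau n.+1.
  have -> : z - a - (z - b) = - (a - b) by ring.
  rewrite normrN; apply: He; first by apply/andP; split; llra.
  by have -> : 1 - s - (1 - t) = - (s - t) by [ring]; rewrite normrN.
- by move=> n; rewrite subrr subr0 B0 subr0 /= addrK.
- move=> n; rewrite subrr subr0 B0.
  by have := tpc (HB (SFT_shift (- n.+1%:Z) x)); llra.
- move=> n s u s0 s1; have [_ _ _ H] := HB (SFT_shift (- n.+1%:Z) x).
  rewrite H; [|llra|llra]; rewrite tauP; congr (leaf h x 0 _); ring.
Qed.

(** Every forward time is reached along the itinerary. *)
Lemma forward_times_reach (x : SFT F) (T : R) : 0 < c -> 0 <= T ->
  exists n s, [/\ 0 <= s, s <= 1 &
    forall u, leaf h (SFT_shift n%:Z x) s u = leaf h x 0 (u + T)].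
Proof.
move=> c0 T0; have [beta [bc b0 b1 bg bP]] := forward_times x.
have grow n : n%:R * c <= beta n 0.
  elim: n => [|n IH]; first by rewrite mul0r b0.
  by rewrite -b1; apply: le_trans (bg _); rewrite -natr1 mulrDl; llra.
have H n : T <= beta n 0 -> exists n s, [/\ 0 <= s, s <= 1 & beta n s = T].
  elim: n => [|n IH] Tb.
    exists 0%N, 0; split=> //.
    by apply/eqP; rewrite eq_le Tb b0 T0.
  have [/IH //|nT] := leP T (beta n 0).
  have [|s] := @IVT _ (beta n) 0 1 T ler01 (bc _).
    by rewrite ge_min (ltW nT) le_max b1 Tb orbT.
  by rewrite in_itv/= => /andP[s0 s1] <-; exists n, s.
have [|n [s [s0 s1 sT]]] := H (Num.truncn (T / c)).+1.
  apply: le_trans (grow _); rewrite -ler_pdivrMr//; apply: ltW.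
  by have /andP[_] := truncn_itv (divr_ge0 T0 (ltW c0)).
by exists n, s; split=> // u; rewrite bP// sT.
Qed.

End Itinerary.

(** * Failure of symbolic coding *)

Section Connections.
Context {R : realType} {X Xt : metricType R} (p : Xt -> X).
Context {rho : R} (injp : injectivity_radius p rho).
Context (psurj : forall y, exists x, p x = y).
Context (plip : forall x y, mdist (p x) (p y) <= mdist x y).

(** The geodesics uniformly close to [y] on [- n, n], up to [1 / (n + 1)] with
    some margin, which makes this set open. *)
Definition window_nbhd (y : R -> X) (n : nat) : set (GX p) :=
  [set g | exists2 e : R, e < n.+1%:R^-1 & forall u, `|u| <= n%:R -> mdist (y u) (g u) <= e].

Lemma window_nbhd_open (y : R -> X) (n : nat) : open (window_nbhd y n).
Proof.
rewrite /window_nbhd; move: (n.+1%:R^-1) => v.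
move=> g [e en He]; have e0 : 0 < (v - e) / 2 by llra.
have [d d0 Hd] := dGX_uniform injp psurj plip (ler0n R n) e0.
exists d => // g' /Hd gg'; exists (e + (v - e) / 2); first by llra.
move=> u un; have := metric_triangle (y u) (g u) (g' u).
by have := He u un; have := gg' u un; llra.
Qed.

Lemma window_nbhd_self (g : GX p) (n : nat) : window_nbhd g n g.
Proof. by exists 0; rewrite ?invr_gt0// => u _; rewrite mdistxx. Qed.

Context (A : finType) (F : seq (seq A)) (h : Susp R F -> GX p).
Context (ose : orbit_semi_equivalence (susp_flow R A F) (geodesic_flow p) h).

Lemma leaf_surj (g : GX p) : exists x s, [/\ 0 <= s, s <= 1 & leaf h x s = g].
Proof.
have [_ hs _] := ose; have [z <-] := hs g.
case E : (repr z) => [x i].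
have /set_itvccP/andP[i0 i1] := set_valP i.
exists x, (\val i); split=> //; rewrite /leaf itv01K -E; congr h.
exact: reprK.
Qed.

(** Any two geodesics lie on leaves whose base points [x1] and [x2] are
    connected: for each [m] some point of the subshift agrees with [x1] on a
    window of size [m] around 0 and, a nonnegative number of steps later, with
    [x2]. *)
Lemma transitive_connection (g1 g2 : GX p) (c : R) :
  topologically_transitive (geodesic_flow p) -> 0 < c ->
  (forall x b, time_piece h x b -> c <= b 1) ->
  exists (x1 : SFT F) (s1 : R) (x2 : SFT F) (s2 : R), [/\ 0 <= s1 <= 1, 0 <= s2 <= 1,
    forall u, leaf h x1 s1 u = g1 u, forall u, leaf h x2 s2 u = g2 u &
    forall m, exists (z : SFT F) (K : nat), agree m (\val x1) (\val z) /\
      agree m (\val x2) (shiftZ K%:Z (\val z))].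
Proof.
move=> tr c0 tpc.
have tp := time_piece_exists ose.
have /choice[q Hq] : forall n : nat, exists q : box R F * box R F,
    [/\ window_nbhd g1 n (h (\pi_(Susp R F)%qT q.1)),
        window_nbhd g2 n (h (\pi_(Susp R F)%qT q.2)) &
        exists K : nat, q.2.1 = SFT_shift K%:Z q.1.1].
  move=> n; have := tr _ _ (@window_nbhd_open g1 n) (@window_nbhd_open g2 n).
  case; [by exists g1; exact: window_nbhd_self|by exists g2; exact: window_nbhd_self|].
  move=> t t0 [_ [[g Wg <-] Wtg]].
  have [x [s [s0 s1 xs]]] := leaf_surj g.
  have [b [_ b0 bi bf]] := tp x.
  have bs0 : 0 <= b s by rewrite -b0; exact: bi.
  have [k [r [r0 r1 kr]]] := forward_times_reach tp tpc x c0 (addr_ge0 t0 bs0).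
  exists ((x, itv01 s), (SFT_shift k%:Z x, itv01 r)); split=> //=.
  - by move: Wg; rewrite -xs.
  - have [e en He] := Wtg; exists e => // u un.
    rewrite -/(leaf h (SFT_shift k%:Z x) r) kr.
    have := He u un; rewrite /= -xs bf//.
    by have -> : u + t + b s = u + (t + b s) by ring.
  - by exists k.
have cK : compact [set: box R F * box R F].
  have cb : compact [set: box R F].
    rewrite -setXTT; apply: compact_setX; [exact: SFT_compact|exact: unit_itv_compact].
  by rewrite -setXTT; apply: compact_setX.
have [[[x1 i1] [x2 i2]] cl] := compact_sequence_cluster q cK.
have /set_itvccP i101 := set_valP i1; have /set_itvccP i201 := set_valP i2.
have ev := evaluation_box_continuous injp psurj plip ose.
have cl2 (b : bool) (U : set (box R F)) : nbhs (if b then (x1, i1) else (x2, i2)) U ->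
    forall N, exists2 n, (N <= n)%N & U (if b then (q n).1 else (q n).2).
  case: b => nU.
    apply: (cl [set w | U w.1]).
    by exists (U, setT) => /=; [split=> //; exact: filterT|move=> w []].
  apply: (cl [set w | U w.2]).
  by exists (setT, U) => /=; [split=> //; exact: filterT|move=> w []].
have limit (b : bool) (g : GX p) :
    (forall n, window_nbhd g n (h (\pi_(Susp R F)%qT (if b then (q n).1 else (q n).2)))) ->
    forall u, h (\pi_(Susp R F)%qT (if b then (x1, i1) else (x2, i2))) u = g u.
  move=> W u; apply/mdist_positivity/eqP; rewrite eq_le mdist_ge0 andbT.
  apply/ler_addgt0Pl => eps eps0; rewrite addr0.
  have e2 : 0 < eps / 2 by llra.
  pose z := if b then (x1, i1) else (x2, i2).
  pose U := [set z' : box R F | mdist (h (\pi_(Susp R F)%qT z) u)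
     (h (\pi_(Susp R F)%qT z') u) < eps / 2].
  have nU : nbhs z U.
    apply: (ev u z [set w | mdist (h (\pi_(Susp R F)%qT z) u) w < eps / 2]).
    by apply/nbhs_mdist; exists (eps / 2).
  have e20 : 0 <= (eps / 2)^-1 by rewrite invr_ge0 ltW.
  have [n nN Un] := cl2 b U nU (maxn (Num.truncn (eps / 2)^-1) (Num.truncn `|u|).+1).
  move: nN; rewrite geq_max => /andP[n1 n2].
  have un : `|u| <= n%:R.
    have /andP[_ /ltW h1] := truncn_itv (normr_ge0 u).
    by apply: le_trans h1 _; rewrite ler_nat.
  have n3 : n.+1%:R^-1 < eps / 2.
    rewrite invf_plt ?posrE//; have /andP[_ h1] := truncn_itv e20.
    by apply: lt_le_trans h1 _; rewrite ler_nat ltnS.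
  have [e en /(_ u un) He] := W n.
  have ee := lt_trans en n3.
  have tri := metric_triangle (h (\pi_(Susp R F)%qT z) u)
    (h (\pi_(Susp R F)%qT (if b then (q n).1 else (q n).2)) u) (g u).
  rewrite (metric_sym (g u)) in He.
  apply: le_trans tri _; rewrite /U/= in Un.
  by clear n3 en; llra.
exists x1, (\val i1), x2, (\val i2); split=> //.
- move=> u; rewrite /leaf itv01K; apply: (limit true) => n.
  by have [] := Hq n.
- move=> u; rewrite /leaf itv01K; apply: (limit false) => n.
  by have [] := Hq n.
move=> m.
have [|n _ [a1 a2]] := cl [set w | agree m (\val x1) (\val w.1.1) /\
    agree m (\val x2) (\val w.2.1)] _ 0%N.
  exists ([set w : box R F | agree m (\val x1) (\val w.1)],
    [set w : box R F | agree m (\val x2) (\val w.1)]) => //=.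
  split.
    exists ([set y : SFT F | agree m (\val x1) (\val y)], setT) => /=.
      by split; [exact: SFT_cylinder|exact: filterT].
    by move=> w [].
  exists ([set y : SFT F | agree m (\val x2) (\val y)], setT) => /=.
    by split; [exact: SFT_cylinder|exact: filterT].
  by move=> w [].
have [_ _ [K EK]] := Hq n.
by exists (q n).1.1, K; split=> //; move: a2; rewrite EK.
Qed.

End Connections.

Section NoOrbitSemiEquivalence.
Context {R : realType} {X Xt : metricType R} (p : Xt -> X).
Context {rho : R} (injp : injectivity_radius p rho).
Context (psurj : forall y, exists x, p x = y).
Context (plip : forall x y, mdist (p x) (p y) <= mdist x y).

Lemma fat_line_no_orbit_semi_equivalence (w : R) (g : R -> Xt)
    (A : finType) (F : seq (seq A)) (h : Susp R F -> GX p) :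
  topologically_transitive (geodesic_flow p) ->
  geodesic_line g -> 0 < w -> fat_line w g ->
  ~ orbit_semi_equivalence (susp_flow R A F) (geodesic_flow p) h.
Proof.
move=> tr gl w0 fw ose; have [rho0 _ _] := injp.
have tp := time_piece_exists ose.
have [c c0 tpc] := time_piece_lower_bound injp psurj plip ose.
have grl := geodesic_line_reverse gl.
have [x1 [s1 [x2 [s2 [/andP[s10 s11] /andP[s20 s21] e1 e2 conn]]]]] :=
  transitive_connection injp psurj plip ose (projected_line injp gl)
    (projected_line injp grl) tr c0 tpc.
have unif := leaf_uniform injp psurj plip ose.
(* at height 0 these leaves are translates of the line and of its reverse *)
have {}e1 : exists b, forall u, leaf h x1 0 u = p (g (u - b)).
  have [b [_ _ _ bf]] := tp x1; exists (b s1) => u.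
  by rewrite -[RHS]/(projected_line injp gl (u - b s1)) -e1 (bf s1)// subrK.
have {}e2 : exists b, forall u, leaf h x2 0 u = p (g (b - u)).
  have [b [_ _ _ bf]] := tp x2; exists (b s2) => u.
  have -> : b s2 - u = - (u - b s2) by ring.
  by rewrite -[RHS]/(projected_line injp grl (u - b s2)) -e2 (bf s2)// subrK.
have [b1 {}e1] := e1; have [b2 {}e2] := e2.
have [z [K [a1 a2]]] := conn (memory F).
have [x [xpast xfuture]] := SFT_splice (leqnn _) a1 a2.
(* the spliced point shares its past with x1 : its leaf is a translate of g *)
have [d Hd] : exists d, forall t, leaf h x 0 t = p (g (t + d)).
  have [beta [bc b1' bg bP]] := backward_times tp tpc x.
  have [kap [kc k1 kg kP]] := backward_times tp tpc x1.
  have [||||||d Hd] := @asymptotic_to_fat_line _ _ _ p rho injp w c (fun s => g (- s))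
    (fun s => leaf h x 0 (- s)) beta (fun n s => kap n s + b1) w0 grl
    (fat_line_reverse fw) (locally_isometric_reverse (gx_loc_iso (leaf h x 0))) bc.
  - move=> n; apply/within_continuous_real => t tab eps eps0.
    have /within_continuous_real/(_ t tab eps eps0)[e e0 He] := kc n.
    exists e => // s sab st; rewrite opprD addrACA subrr addr0; exact: He.
  - exact: b1'.
  - by move=> n; rewrite k1.
  - exact: c0.
  - exact: bg.
  - move=> u eps eps0; have [m Hm] := unif (- u) eps eps0.
    exists m => n s mn /andP[s0 s1'].
    have := Hm (SFT_shift (- n.+1%:Z) x) (SFT_shift (- n.+1%:Z) x1) (1 - s).
    rewrite bP// kP// e1.
    have -> : - u - beta n s = - (beta n s + u) by ring.
    have -> : - u - kap n s - b1 = - (kap n s + b1 + u) by ring.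
    by apply; exact: agree_past.
  exists (- d) => t; have := Hd (- t); rewrite opprK => ->.
  by congr (p (g _)); ring.
(* and its future with x2 : the reverse of g is a translate of g *)
have [d' Hd'] : exists d, forall t, leaf h x2 0 t = p (g (t + d)).
  have [beta [bc _ b1' bg bP]] := forward_times tp tpc x2.
  have [tau [_ _ _ _ tauP]] := forward_times tp tpc x.
  have [kap [kc _ k1 kg kP]] := forward_times tp tpc (SFT_shift K%:Z x).
  apply: (@asymptotic_to_fat_line _ _ _ p rho injp w c g
    (leaf h x2 0) beta (fun n s => kap n s + (tau K 0 + d)) w0 gl
    fw (gx_loc_iso (leaf h x2 0)) bc).
  - move=> n; apply/within_continuous_real => t tab eps eps0.
    have /within_continuous_real/(_ t tab eps eps0)[e e0 He] := kc n.
    exists e => // s sab st; rewrite opprD addrACA subrr addr0; exact: He.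
  - exact: b1'.
  - by move=> n; rewrite k1.
  - exact: c0.
  - exact: bg.
  - move=> u eps eps0; have [m Hm] := unif u eps eps0.
    exists m => n s mn /andP[s0 s1'].
    have := Hm (SFT_shift n%:Z x2) (SFT_shift n%:Z (SFT_shift K%:Z x)) s.
    rewrite bP// kP// tauP// Hd.
    have -> : u + beta n s = beta n s + u by ring.
    have -> : u + kap n s + tau K 0 + d = kap n s + (tau K 0 + d) + u by ring.
    by apply; exact: agree_future.
have [s _] := @opposite_lines_diverge _ _ _ p rho injp g d' b2 0 gl rho0 ltac:(lra).
by rewrite -e2 Hd' addrC mdistxx ltxx.
Qed.

End NoOrbitSemiEquivalence.

Theorem theorem3p4 (R : realType) (X Xt : metricType R) (p : Xt -> X) :
  compact [set: X] ->
  geodesic_space X ->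
  locally_CAT0 X ->
  universal_cover p ->
  topologically_transitive (geodesic_flow p) ->
  has_fat_1flat Xt ->
  ~ weak_specification (dGX p) (geodesic_flow p) /\
  (forall (A : finType) (F : seq (seq A)),
     ~ exists h : Susp R F -> GX p,
         orbit_semi_equivalence (susp_flow R A F) (geodesic_flow p) h).
Proof.
move=> cX gX _ uc tr [g gl [w w0 fw]].
have [rho injp] := injectivity_radius_exists cX gX uc.
have [_ [_ psurj _] _] := uc.
have plip x y := universal_cover_lipschitz x y uc.
split; first exact: (fat_line_no_weak_specification injp psurj plip gl w0 fw).
move=> A F [h].
exact: (fat_line_no_orbit_semi_equivalence injp psurj plip tr gl w0 fw).
Qed.
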